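(* The isomorphism classes of marked elliptic root systems with non-reduced affine quotient are classified by their elliptic diagrams: if $(R_1,G_1)$ and $(R_2,G_2)$ are marked elliptic root systems whose affine quotients $R_1/G_1$ and $R_2/G_2$ are non-reduced, then $(R_1,G_1)$ and $(R_2,G_2)$ are isomorphic if and only if their elliptic diagrams $\Gamma(R_1,G_1)$ and $\Gamma(R_2,G_2)$ are isomorphic.
   Context: Root systems. Let $F$ be a finite-dimensional real vector space with a symmetric bilinear form $I$. For $\alpha\in F$ with $I(\alpha,\alpha)\ne0$ put $\alpha^\vee=2\alpha/I(\alpha,\alpha)$ and $r_\alpha(\lambda)=\lambda-I(\alpha^\vee,\lambda)\alpha$. A root system belonging to $(F,I)$ is a subset $R\subset F\setminus\{0\}$ such that: (R1) the subgroup $Q(R)$ generated by $R$ is a full lattice in $F$; (R2) $I(\alpha,\alpha)\neq0$ for $\alpha\in R$; (R3) $r_\alpha(R)=R$ for $\alpha\in R$; (R4) $I(\alpha^\vee,\beta)\in\mathbb Z$ for $\alpha,\beta\in R$; (R5) if $R=R_1\sqcup R_2$ with $R_1\perp R_2$, then $R_1=\emptyset$ or $R_2=\emptyset$. $R$ is reduced if $\alpha,c\alpha\in R$ ($c\in\mathbb R$) implies $c=\pm1$, otherwise non-reduced. $R$ is elliptic if $I$ has signature $(l,2,0)$ ($l\ge1$ positive directions, $2$-dimensional radical, no negative direction), affine if the signature is $(l,1,0)$. A marked elliptic root system (mERS) is a pair $(R,G)$ with $R$ elliptic and $G\subset\mathrm{rad}(I)$ a one-dimensional subspace such that $G\cap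 Q(R)$ has rank $1$. Let $\pi_G:F\to F/G$ be the projection, $\bar\alpha=\pi_G(\alpha)$; the affine quotient $R/G=\pi_G(R)$ is an affine root system for the induced form $I_{F/G}$. Two mERSs are isomorphic if there is a linear isomorphism $\varphi:F_1\to F_2$ with $\varphi(R_1)=R_2$, $\varphi(G_1)=G_2$. Paired simple systems. Fix a generator $a$ of $Q(R)\cap G$. For $\alpha\in R$ put $k(\alpha)=\min\{k\in\mathbb Z_{>0}:\alpha+ka\in R\}$ (counting number) and $\alpha^\ast=\alpha+k(\alpha)a$. Let $R^{\mathrm{dc}}=\{\alpha\in R:\frac12\alpha\notin R\}$. For $\alpha\in R$ define $\alpha'\in R$: $\alpha'=\alpha$ if $2\bar\alpha\notin R/G$; otherwise $\alpha'$ is the unique element of $R\cap\pi_G^{-1}(2\bar\alpha)$ (a subset of $2\alpha+\mathbb Za$) with $\alpha'\in2\alpha+\mathbb Z_{\le0}a$ and $(\alpha')^\ast\in2\alpha+\mathbb Z_{>0}a$. A simple system of an affine root system is a basis of the ambient space consisting of roots such that every root is an integral combination of it with all coefficients $\ge0$ or all $\le0$. A paired simple system is a pair $(\Pi^{\mathrm{dc}},\Pi^{\mathrm{mc}})$ where $\Pi^{\mathrm{dc}}=\{\alpha_0,\dots,\alpha_l\}\subset R^{\mathrm{dc}}$ has image $\{\bar\alpha_0,\dots,\bar\alpha_l\}$ a simple system of $R^{\mathrm{dc}}/G$ (equivalently of $R/G$), satisfies: if some $\beta\in\pi_G^{-1}(\bar\alpha_i)\cap R$ has $2\beta\notin R$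 then $2\alpha_i\notin R$; and $\Pi^{\mathrm{mc}}=\{\alpha_0',\dots,\alpha_l'\}$. Exponents. For $x,y\in F$ with $\bar x=c\bar y\neq0$ put $(x:y)_G=c$. For $\alpha\in\Pi^{\mathrm{dc}}$ define $k^{\mathrm{nr}}(\alpha)$ by $\alpha=(\alpha:(\alpha')^\ast)_G(\alpha')^\ast-k^{\mathrm{nr}}(\alpha)a$. Let $I_R$ be the positive multiple of $I$ for which the values $I_R(\alpha,\alpha)$, $\alpha\in R$, are integers with greatest common divisor $2$. Let $n_\alpha$ ($\alpha\in\Pi^{\mathrm{dc}}$) be the positive integers such that $\sum n_\alpha\bar\alpha$ generates $Q(R/G)\cap\mathrm{rad}(I_{F/G})$. The exponent of $\alpha$ is $m_\alpha=\frac{I_R(\alpha,\alpha)}{2k^{\mathrm{nr}}(\alpha)}n_\alpha$; $m_{\max}=\max_\alpha m_\alpha$. Elliptic diagram (for $R/G$ non-reduced). It is formed from any choice of paired simple system (up to isomorphism it does not depend on the choice). The node set of $\Gamma(R,G)$ is the disjoint union $\Pi^{\mathrm{dc}}\sqcup\{(\alpha')^\ast:\alpha\in\Pi^{\mathrm{dc}},\ m_\alpha=m_{\max}\}$. A node $\gamma$ is black if $2\gamma\in R$ or $\frac12\gamma\in R$; gray if $2\gamma,\frac12\gamma\notin R$ but $2\bar\gamma\in R/G$ or $\frac12\bar\gamma\in R/G$; white otherwise. Edges between nodes $\alpha,\beta$ are drawn according to the integers $I(\alpha,\beta^\vee),I(\beta,\alpha^\vee)$: no edge if $0$; simple edge if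 both are $-1$; arrowed edge labelled $t\in\{2,3,4\}$ if they are $-1,-t$; edge labelled $\infty$ if both are $-2$; dashed double edge if both are $2$; arrowed dashed double edge if $I(\alpha^\vee,\beta)=4$, $I(\alpha,\beta^\vee)=1$ and $\bar\beta=2\bar\alpha$. Isomorphism of elliptic diagrams: a bijection $\varphi$ of node sets such that (i) $\varphi$ respects the splitting of the node set into the two parts above; (ii) $I_1(\alpha,\beta^\vee)=I_2(\varphi(\alpha),\varphi(\beta)^\vee)$ for all nodes; (iii) $m_\alpha=m_{\varphi(\alpha)}$ for $\alpha\in\Pi_1^{\mathrm{dc}}$; (iv) $\varphi$ preserves the colours of nodes. *)

(* Defs.v *)
From HB Require Import structures.
From mathcomp Require Import all_boot all_order all_algebra sesquilinear.
From mathcomp Require Import boolp classical_sets reals.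

Set Implicit Arguments.
Unset Strict Implicit.
Unset Printing Implicit Defensive.

Import Order.TTheory GRing.Theory Num.Theory.

Local Open Scope classical_set_scope.
Local Open Scope ring_scope.

Section Lattices.
Variables (R : realType) (V : vectType R).
Implicit Types (S : set V) (X : seq V).

Definition subgroup S := S 0 /\ forall x y, S x -> S y -> S (x - y).

Definition subgroup_gen S : set V := smallest subgroup S.

Definition int_span X : set V :=
  [set x | exists c : 'I_(size X) -> int, x = \sum_(i < size X) X`_i *~ c i].

Definition int_free X :=
  forall c : 'I_(size X) -> int,
    \sum_(i < size X) X`_i *~ c i = 0 -> forall i, c i = 0.

Definition full_lattice S := exists2 X, basis_of fullv X & S = int_span X.

Definition int_rank S (n : nat) :=
  exists X, [/\ size X = n, int_free X & S = int_span X].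

Definition generator S (x : V) := S = [set x *~ z | z in setT].

End Lattices.

Section RootSystems.
Variables (R : realType) (V : vectType R) (I : V -> V -> R).
Implicit Types (S : set V) (X : seq V).

Definition radical : set V := [set x | forall y, I x y = 0].

Definition coroot (x : V) : V := (2 / I x x) *: x.

Definition reflection (x y : V) : V := y - I (coroot x) y *: x.

Definition orthogonal_sets S1 S2 := forall x y, S1 x -> S2 y -> I x y = 0.

Definition root_system S :=
  [/\ ~ S 0 /\ full_lattice (subgroup_gen S),
      forall x, S x -> I x x != 0,
      forall x, S x -> reflection x @` S = S,
      forall x y, S x -> S y -> exists z : int, I (coroot x) y = z%:~R
    & forall S1 S2, S = S1 `|` S2 -> S1 `&` S2 = set0 ->
        orthogonal_sets S1 S2 -> S1 = set0 \/ S2 = set0].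

Definition reduced S :=
  forall x (c : R), S x -> S (c *: x) -> c = 1 \/ c = -1.

(* p positive, z null and n negative directions, in this order *)
Definition has_signature (p z n : nat) :=
  exists X, [/\ basis_of fullv X,
    forall i j, (i < size X)%N -> (j < size X)%N -> i != j -> I X`_i X`_j = 0,
    count (fun x => 0 < I x x) X = p,
    count (fun x => I x x == 0) X = z
  & count (fun x => I x x < 0) X = n].

Definition elliptic S :=
  root_system S /\ exists2 l, (0 < l)%N & has_signature l 2 0.

Definition simple_system S X :=
  [/\ basis_of fullv X,
      forall x, x \in X -> S x
    & forall y, S y -> exists c : 'I_(size X) -> int,
        y = \sum_(i < size X) X`_i *~ c i /\
        ((forall i, 0 <= c i) \/ (forall i, c i <= 0))].

End RootSystems.

Section Quotient.
Variables (R : realType) (V : vectType R) (G : {vspace V}).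

(* V / G is realised on the complement G^C of G, the projection being the one
   along G; see quot_proj_eq and quot_projK *)
Definition quot : vectType R := subvs_of (G^C)%VS.

Definition quot_proj (x : V) : quot := vsproj (G^C)%VS (daddv_pi (G^C)%VS G x).

Definition quot_form (I : V -> V -> R) (u v : quot) : R := I (vsval u) (vsval v).

Lemma quot_proj_linear : linear quot_proj.
Proof. by move=> c x y; rewrite /quot_proj !linearP. Qed.

HB.instance Definition _ :=
  GRing.isSemilinear.Build R V quot _ quot_proj
    (GRing.semilinear_linear quot_proj_linear).

Lemma quot_projK : cancel (vsval : quot -> V) quot_proj.
Proof.
move=> u; rewrite /quot_proj daddv_pi_id ?vsvalK ?subvsP //.
by rewrite capvC capv_compl.
Qed.

Lemma quot_proj_dec (x : V) : x - vsval (quot_proj x) \in G.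
Proof.
have dGC : (G^C :&: G = 0)%VS by rewrite capvC capv_compl.
have xGC : x \in (G^C + G)%VS by rewrite addvC addv_complf memvf.
rewrite /quot_proj vsprojK ?memv_pi //.
by rewrite -{1}(daddv_pi_add dGC xGC) addrC addKr memv_pi.
Qed.

Lemma quot_proj_eq (x y : V) : quot_proj x = quot_proj y <-> x - y \in G.
Proof.
have ker z : z \in G -> quot_proj z = 0.
  move=> Gz; have /eqP : vsval (quot_proj z) == 0.
    rewrite -memv0 -(capv_compl G) memv_cap subvsP andbT.
    by rewrite -(subKr z (vsval _)) rpredB // quot_proj_dec.
  move=> h; apply/val_inj/(etrans h)/esym.
  exact: (linear0 (vsval : subvs_of (G^C)%VS -> V)).
split=> [e|/ker].
  have -> : x - y = (x - vsval (quot_proj x)) - (y - vsval (quot_proj y)).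
    by rewrite e opprB addrA subrK.
  by rewrite rpredB ?quot_proj_dec.
by rewrite linearB => /eqP; rewrite subr_eq0 => /eqP.
Qed.

End Quotient.

Section MarkedEllipticRootSystems.
Variables (R : realType) (F : vectType R) (I : F -> F -> R).
Variables (S : set F) (G : {vspace F}).

Local Notation proj := (quot_proj G).

Definition root_quot : set (quot G) := proj @` S.

Definition marked_elliptic :=
  [/\ elliptic I S, \dim G = 1%N, [set x | x \in G] `<=` radical I
    & int_rank (subgroup_gen S `&` [set x | x \in G]) 1].

(* [a] is meant to be a generator of Q(S) /\ G *)
Variable a : F.

Definition counting_number (x : F) : nat :=
  xget 0%N [set k | [/\ (0 < k)%N, S (x + a *+ k)
    & forall j, (0 < j)%N -> S (x + a *+ j) -> (k <= j)%N]].

Definition star (x : F) : F := x + a *+ counting_number x.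

Definition roots_dc : set F := [set x | S x /\ ~ S (2^-1 *: x)].

Definition prime_set (x : F) : set F :=
  [set y | [/\ S y, proj y = 2 *: proj x,
      exists2 z : int, z <= 0 & y = 2 *: x + a *~ z
    & exists2 z : int, 0 < z & star y = 2 *: x + a *~ z]].

Definition prime_root (x : F) : F :=
  if `[< root_quot (2 *: proj x) >] then xget x (prime_set x) else x.

Section Diagram.
Variable n : nat.
Implicit Types (Pi : n.-tuple F) (P : n.-tuple F * n.-tuple F).

(* P = (Pi^dc, Pi^mc), both listed in the same order *)
Definition paired_simple_system P :=
  [/\ forall i, roots_dc (tnth P.1 i),
      simple_system (proj @` roots_dc) (map proj P.1),
      forall i, (exists y, [/\ S y, proj y = proj (tnth P.1 i) & ~ S (2 *: y)]) ->
        ~ S (2 *: tnth P.1 i)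
    & P.2 = [tuple of map prime_root P.1]].

(* (x : y)_G *)
Definition quot_ratio (x y : F) : R := xget 0 [set c | proj x = c *: proj y].

Definition knr (x : F) : R :=
  xget 0 [set k | x = quot_ratio x (star (prime_root x)) *: star (prime_root x)
                      - k *: a].

Definition is_gcd (Z : set int) (d : int) :=
  [/\ 0 <= d, forall z, Z z -> (d %| z)%Z
    & forall e : int, (forall z, Z z -> (e %| z)%Z) -> (e %| d)%Z].

(* the positive factor c such that I_R = c I *)
Definition form_scale : R :=
  xget 1 [set c | [/\ 0 < c,
    forall x, S x -> exists z : int, c * I x x = z%:~R
    & is_gcd [set z | exists2 x, S x & c * I x x = z%:~R] 2]].

Definition null_coef Pi : {ffun 'I_n -> nat} :=
  xget [ffun=> 0%N] [set c : {ffun 'I_n -> nat} | (forall i, (0 < c i)%N) /\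
    generator (subgroup_gen root_quot `&` radical (quot_form I))
              (\sum_i proj (tnth Pi i) *+ c i)].

Definition exponent Pi (i : 'I_n) : R :=
  form_scale * I (tnth Pi i) (tnth Pi i) / (2 * knr (tnth Pi i))
  * (null_coef Pi i)%:R.

Definition max_exponent Pi (i : 'I_n) : bool :=
  [forall j, exponent Pi j <= exponent Pi i].

End Diagram.

End MarkedEllipticRootSystems.

Arguments root_quot {R F} S G _.

Inductive colour := Black | Gray | White.

(* Nodes are the disjoint union of [dc_node] and [star_node].  The edge between
   two nodes x and y is a drawing of the pair of numbers
   (pairing x y, pairing y x) = (I(x, y^v), I(y, x^v)), which is what is
   recorded here. *)
Record elliptic_diagram (R : realType) := EllipticDiagram {
  dc_node : finType;
  star_node : finType;
  pairing : dc_node + star_node -> dc_node + star_node -> R;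
  dc_exponent : dc_node -> R;
  node_colour : dc_node + star_node -> colour }.

Definition diagram_iso (R : realType) (D1 D2 : elliptic_diagram R) :=
  exists f : dc_node D1 + star_node D1 -> dc_node D2 + star_node D2,
  [/\ bijective f,
      forall x, (if f x is inl _ then true else false) =
                (if x is inl _ then true else false),
      forall x y, pairing x y = pairing (f x) (f y),
      forall i j, f (inl i) = inl j -> dc_exponent i = dc_exponent j
    & forall x, node_colour (f x) = node_colour x].

Section DiagramOf.
Variables (R : realType) (F : vectType R) (I : F -> F -> R).
Variables (S : set F) (G : {vspace F}) (a : F).

Definition colour_of (x : F) : colour :=
  if `[< S (2 *: x) \/ S (2^-1 *: x) >] then Black
  else if `[< root_quot S G (2 *: quot_proj G x) \/
              root_quot S G (2^-1 *: quot_proj G x) >] then Gray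
  else White.

Variables (n : nat) (P : n.-tuple F * n.-tuple F).

Definition star_index := {i : 'I_n | max_exponent I S G a P.1 i}.

Definition node_root (x : 'I_n + star_index) : F :=
  match x with
  | inl i => tnth P.1 i
  | inr i => star S a (tnth P.2 (val i))
  end.

Definition diagram_of : elliptic_diagram R :=
  @EllipticDiagram R 'I_n star_index
    (fun x y => I (node_root x) (coroot I (node_root y)))
    (exponent I S G a P.1)
    (fun x => colour_of (node_root x)).

End DiagramOf.

Definition mers_iso (R : realType) (F1 F2 : vectType R)
    (S1 : set F1) (G1 : {vspace F1}) (S2 : set F2) (G2 : {vspace F2}) :=
  exists f : 'Hom(F1, F2),
    [/\ bijective f, f @` S1 = S2 & (f @: G1)%VS = G2].

(* Main.v *)
(* A root x of R has fibre x + k(x) Z a over its image in R/G, because a subset of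
   Z stable under reflections in its points is a coset of a subgroup.  Hence R is
   recovered from the Cartan matrix of the simple roots al_i, the counting numbers
   k_i = k(al_i) and the fibres over the doubled roots 2 al_i.  With q_i = knr(al_i)
   the vector al_i + q_i a is proportional to a root; the fibre over 2 al_i, if
   nonempty, is 2 q_i Z or 2 q_i + 4 q_i Z according to the colour of al_i, and k_i
   is q_i or 2 q_i according to the colour of the star node.  The exponents
   determine the q_i, because null_coef and form_scale depend on the Cartan matrix
   only.  A star node that would be needed to tell k_i = 2 q_i from k_i = q_i is
   always drawn: if k_i = 2 q_i and 2 al_i meets R/G, the exponent of al_i is
   maximal, since the exponents decrease along chains issuing from al_i.

   Conversely, an isomorphism preserves the Cartan integers (reflections are
   determined by root strings), and two simple systems of R/G are conjugate under
   the Weyl group up to sign, so all these data agree. *)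

Require Import Defs.
From HB Require Import structures.
From mathcomp Require Import all_boot all_order all_algebra sesquilinear.
From mathcomp Require Import boolp classical_sets reals.
From mathcomp Require Import zify ring lra.

Set Implicit Arguments.
Unset Strict Implicit.
Unset Printing Implicit Defensive.

Import Order.TTheory GRing.Theory Num.Theory.

Local Open Scope classical_set_scope.
Local Open Scope ring_scope.
Import VectorInternalTheory.

(** The argument stays in [F]: a [base] is a basis of [F] modulo the line of [a], and coordinates
    along [a] are carried as real parameters. The obstacle is that lifts of simple roots are not
    canonical: conjugating one paired system into another only sends [al_i] to [al_(f i) + s_i a]
    with uncontrolled [s_i]. The intermediate notion [data_iso] therefore consists of what survives
    such shifts: Cartan integers, existence and periods of fibres, and whether [2 al_i] is a root,
    which survives thanks to the pairing condition. The Weyl group is infinite, so conjugacy needs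
    its own descent: two height functionals, rescaled to agree on the null vector, differ by a
    functional that the semidefinite form represents, and the norm of the representing vector is the
    measure. Maximality of an exponent is obtained without classification. With n the null
    coefficients and u_i = n_i I(al_i, al_i), the exponents are proportional to u_i / q_i, and
    nullity reads: 2 u_i is the sum of the u_j (- C_ji) over j different from i. Exponents are
    compared through this identity. *)

Ltac vring := apply: (can_inj (v2rK));
  rewrite ?(linearD, linearB, linearN, linearZ, linear0) /=;
  apply/rowP => ?; rewrite !mxE; ring.
Ltac vfield := apply: (can_inj (v2rK));
  rewrite ?(linearD, linearB, linearN, linearZ, linear0) /=;
  apply/rowP => ?; rewrite !mxE; field.

(** * Simple systems of affine quotients *)

Section Form.
Variables (R : realType) (F : vectType R) (I : {symmetric F}).

Definition cart (x y : F) : R := 2 / I x x * I x y.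

Lemma formC (x y : F) : I x y = I y x.
Proof. by rewrite hermC /= expr0 mul1r. Qed.

Lemma formDl (x y z : F) : I (x + y) z = I x z + I y z.
Proof. exact: linearDl. Qed.

Lemma formZl c (x z : F) : I (c *: x) z = c * I x z.
Proof. by rewrite linearZl_LR. Qed.

Lemma formDr (z x y : F) : I z (x + y) = I z x + I z y.
Proof. by rewrite formC formDl !(formC _ z). Qed.

Lemma formZr c (z x : F) : I z (c *: x) = c * I z x.
Proof. by rewrite formC formZl formC. Qed.

Lemma formNl (x z : F) : I (- x) z = - I x z.
Proof. by rewrite -scaleN1r formZl mulN1r. Qed.

Lemma formNr (z x : F) : I z (- x) = - I z x.
Proof. by rewrite formC formNl formC. Qed.

Definition formE := (formDl, formDr, formNl, formNr, formZl, formZr).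

Lemma form_suml (J : finType) (f : J -> F) z :
  I (\sum_i f i) z = \sum_i I (f i) z.
Proof. exact: linear_sumlz. Qed.

Lemma form_sumr (J : finType) (f : J -> F) z :
  I z (\sum_i f i) = \sum_i I z (f i).
Proof. by rewrite formC form_suml; apply: eq_bigr => i _; apply: formC. Qed.

Lemma reflE (x y : F) : reflection I x y = y - cart x y *: x.
Proof. by rewrite /reflection /coroot formZl. Qed.

Lemma coroot_cart (x y : F) : I y (coroot I x) = cart x y.
Proof. by rewrite /coroot formC formZl. Qed.

Lemma cartDr (x y z : F) : cart x (y + z) = cart x y + cart x z.
Proof. by rewrite /cart formDr mulrDr. Qed.

Lemma cartZr c (x y : F) : cart x (c *: y) = c * cart x y.
Proof. by rewrite /cart formZr mulrCA. Qed.

Lemma cartxx (x : F) : I x x != 0 -> cart x x = 2.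
Proof. by move=> nz; rewrite /cart divfK. Qed.

Lemma cart_scalel c (x y : F) : c != 0 -> cart (c *: x) y = c^-1 * cart x y.
Proof.
move=> nz; rewrite /cart !formE.
have [->|nz'] := eqVneq (I x x) 0; first by rewrite !mulr0 invr0; ring.
by field; rewrite nz nz'.
Qed.

Lemma refl_scale c (x y : F) : c != 0 ->
  reflection I (c *: x) y = reflection I x y.
Proof.
move=> nz; rewrite !reflE cart_scalel // scalerA mulrAC mulVf // mul1r //.
Qed.

Lemma cart_refl (x y : F) : I x x != 0 ->
  cart x (reflection I x y) = - cart x y.
Proof. by move=> nz; rewrite reflE -scaleNr cartDr cartZr cartxx //; ring. Qed.

Lemma reflK (x : F) : I x x != 0 -> involutive (reflection I x).
Proof.
move=> nz y; rewrite [LHS]reflE cart_refl // reflE; vring.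
Qed.

Lemma form_refl (x y z : F) : I x x != 0 ->
  I (reflection I x y) (reflection I x z) = I y z.
Proof.
by move=> nz; rewrite !reflE !formE /cart (formC y x); field.
Qed.

End Form.

Section RootDatum.
Variables (R : realType) (F : vectType R) (I : {symmetric F}).
Variables (S : set F) (a : F).
Local Notation cart := (cart I).

(* [a] stands for a generator of Q(R) /\ G. *)
Record mers : Prop := Mers {
  mers_pos : forall x, 0 <= I x x;
  mers_rad : forall y, I a y = 0;
  mers_null : exists2 v, (forall y, I v y = 0) & forall t, v != t *: a;
  mers_nz : forall x, S x -> I x x != 0;
  mers_refl : forall x y, S x -> S y -> S (reflection I x y);
  mers_int : forall x y, S x -> S y -> exists z : int, cart x y = z%:~R;
  mers_irr : forall S1 S2, S = S1 `|` S2 -> S1 `&` S2 = set0 ->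
    orthogonal_sets I S1 S2 -> S1 = set0 \/ S2 = set0;
  mers_fib : forall x t, S x -> S (x + t *: a) -> exists z : int, t = z%:~R;
  mers_a0 : a != 0;
  mers_gen : subgroup_gen S a }.

Definition same_sign n (c : 'I_n -> int) :=
  (forall i, 0 <= c i) \/ (forall i, c i <= 0).

(** A simple system of the quotient, lifted to [F]. The coordinate [t] along [a] is an arbitrary
    real: the position of a root in its fibre is deliberately left open. *)
Record base n (al : 'I_n -> F) : Prop := Base {
  base_S : forall i, S (al i);
  base_free : forall (c : 'I_n -> R) t, \sum_i c i *: al i + t *: a = 0 ->
    (forall i, c i = 0) /\ t = 0;
  base_span : forall x, exists (c : 'I_n -> R) t,
    x = \sum_i c i *: al i + t *: a;
  base_sign : forall x, S x -> exists (c : 'I_n -> int) t,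
    x = \sum_i (c i)%:~R *: al i + t *: a /\ same_sign c }.

Hypothesis M : mers.

Lemma formar y : I y a = 0. Proof. by rewrite formC mers_rad. Qed.

Lemma mers_gt0 x : S x -> 0 < I x x.
Proof. by move=> Sx; rewrite lt_def mers_nz // mers_pos. Qed.

Lemma mers_opp x : S x -> S (- x).
Proof.
move=> Sx; have := mers_refl M Sx Sx.
by rewrite reflE cartxx ?mers_nz // scaler_nat mulr2n opprD addrA subrr add0r.
Qed.

Lemma null_rad x : I x x = 0 -> forall y, I x y = 0.
Proof.
move=> x0 y; have [// |nz] := eqVneq (I x y) 0.
(* The coefficient is chosen so that this vector has norm [-1]. *)
have := mers_pos M (y + (- (I y y + 1) / (2 * I x y)) *: x).
rewrite !formE x0 (formC I y x).
have -> : - (I y y + 1) / (2 * I x y) * I x y = - (I y y + 1) / 2 by field.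
lra.
Qed.

Lemma form_shift x s y t : I (x + s *: a) (y + t *: a) = I x y.
Proof. by rewrite !formE !(mers_rad M) formar; ring. Qed.

Lemma cart_a x t y : cart (x + t *: a) y = cart x y.
Proof. by rewrite /cart !formE !(mers_rad M) formar; congr (2 / _ * _); ring. Qed.

Lemma cart_ar x y t : cart x (y + t *: a) = cart x y.
Proof. by rewrite cartDr cartZr /cart formar; ring. Qed.

Lemma reflection_stable c x : c != 0 -> S (c *: x) ->
  forall y, S y -> S (reflection I x y).
Proof. by move=> nz Sx y Sy; rewrite -(refl_scale _ _ _ nz); apply: mers_refl. Qed.

(** Two reflections whose vectors differ by a multiple of [a] compose to a translation along [a].
    This is how a shift in one fibre is carried to another one, multiplied by a Cartan integer. *)
Lemma refl_shift x y t : I x x != 0 ->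
  reflection I (x + t *: a) (reflection I x y) = y + (t * cart x y) *: a.
Proof.
by move=> nz; rewrite [LHS]reflE cart_a cart_refl // reflE; vring.
Qed.

Lemma mers_shift x t y : S x -> S (x + t *: a) -> S y ->
  S (y + (t * cart x y) *: a).
Proof.
move=> Sx Sxt Sy; rewrite -refl_shift ?mers_nz //.
by do !apply: mers_refl => //.
Qed.

Section Base.
Variables (n : nat) (al : 'I_n -> F).
Hypothesis B : base al.

Local Notation A i j := (I (al i) (al j)).

Definition comb (c : 'I_n -> R) t := \sum_i c i *: al i + t *: a.

Lemma comb_inj c t c' t' : comb c t = comb c' t' -> c =1 c' /\ t = t'.
Proof.
move=> e; have e0 : \sum_i (c i - c' i) *: al i + (t - t') *: a = 0.
  under eq_bigr do rewrite scalerBl.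
  by rewrite sumrB scalerBl addrACA -opprD -/(comb c t) e subrr.
have [h /eqP] := base_free B e0.
by rewrite subr_eq0 => /eqP ->; split=> // i; apply/eqP; rewrite -subr_eq0 h.
Qed.

Lemma form_comb c t y : I (comb c t) y = \sum_i c i * I (al i) y.
Proof.
rewrite /comb !formE (mers_rad M) mulr0 addr0 form_suml.
by apply: eq_bigr => i _; rewrite formZl.
Qed.

Lemma comb_sub i c t m : comb c t - m *: al i =
  comb (fun j => c j - m *+ (j == i)) t.
Proof.
rewrite /comb; under [in RHS]eq_bigr do rewrite scalerBl.
rewrite sumrB (bigD1 i) //= [X in _ = _ - X + _](bigD1 i) //= eqxx mulr1n.
rewrite [X in _ - (_ + X)]big1 ?addr0 => [|j /negPf -> /=]; last first.
  by rewrite scale0r.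
by rewrite addrAC.
Qed.

Lemma comb1 i t : al i + t *: a = comb (fun j => (j == i)%:R) t.
Proof.
congr (_ + _); rewrite (bigD1 i) //= eqxx scale1r big1 ?addr0 // => j /negPf ->.
by rewrite scale0r.
Qed.

Lemma combZ i c t : (forall j, j != i -> c j = 0) ->
  comb c t = c i *: al i + t *: a.
Proof.
move=> h; congr (_ + _); rewrite (bigD1 i) //= big1 ?addr0 // => j /h ->.
by rewrite scale0r.
Qed.

Lemma base_gt0 i : 0 < A i i. Proof. exact: mers_gt0 (base_S B i). Qed.

Lemma cart_le0 i j : i != j -> cart (al i) (al j) <= 0.
Proof.
move=> ij; rewrite leNgt; apply/negP => p.
have [z ez] := mers_int M (base_S B i) (base_S B j).
have := mers_refl M (base_S B i) (base_S B j).
rewrite reflE ez -[al j]addr0 -(scale0r a) comb1 comb_sub.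
move=> /(base_sign B)[c [t [/comb_inj[e _]]]].
move: (e i) (e j); rewrite eqxx [j == i]eq_sym (negPf ij) eqxx subr0 sub0r /=.
move: p; rewrite ez ltr0z => zp.
rewrite mulr1n ?subr0 -mulrNz => /intr_inj ei.
rewrite -[1]/(1%:~R) => /intr_inj ej.
case=> [h|h]; first by move: (h i); rewrite -ei; lia.
by move: (h j); rewrite -ej; lia.
Qed.

Lemma cart_form x y : S x -> cart x y * I x x = 2 * I x y.
Proof. by move=> Sx; rewrite /cart; field; rewrite mers_nz. Qed.

Lemma form_le0 i j : i != j -> A i j <= 0.
Proof.
move=> ij; have := cart_le0 ij; have := cart_form (al j) (base_S B i).
have := base_gt0 i; nra.
Qed.

(** Simple reflections lower the height until, modulo [a], only a multiple of one simple root is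
    left; integrality of pairings then allows the factors 1 and 2 up to sign. Reflections being
    involutions, [Q] can be pulled back along the descent. *)
Lemma root_ind (Q : F -> Prop) :
  (forall i x t, S x -> x = al i + t *: a -> Q x) ->
  (forall i x t, S x -> x = 2 *: al i + t *: a -> Q x) ->
  (forall i x, S x -> Q x -> Q (reflection I (al i) x)) ->
  forall x, S x -> Q x.
Proof.
move=> Q1 Q2 Qr.
have QN : forall i x, S x -> Q (reflection I (al i) x) -> Q x.
  move=> i x Sx Qx; rewrite -(reflK (mers_nz M (base_S B i)) x); apply: Qr => //.
  exact: mers_refl (base_S B i) Sx.
have main : forall (N : nat) x (c : 'I_n -> int) t, S x ->
    x = comb (fun i => (c i)%:~R) t -> same_sign c ->
    (\sum_i `|c i| < N)%N -> Q x.
  elim=> // N IH x c t Sx ex sc lN.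
  (* Otherwise expanding the first argument of [I x x] would give a norm [<= 0]. *)
  have [i Hi] : exists i, 0 < (c i)%:~R * I (al i) x.
    apply: contrapT => /forallNP h.
    have := mers_gt0 Sx; rewrite {1}ex form_comb ltNge => /negP; apply.
    by apply: sumr_le0 => i _; rewrite leNgt; apply/negP.
  have [m em] := mers_int M (base_S B i) Sx.
  have cf := cart_form x (base_S B i); have gt0 := base_gt0 i.
  have cm : 0 < c i * m.
    rewrite -(ltr0z R) intrM -em; nra.
  have [[j /andP[ji cj]]|nj] := pselect (exists j, (j != i) && (c j != 0)).
    apply: (QN i) => //.
    have Sr := mers_refl M (base_S B i) Sx.
    pose c' j := c j - m *+ (j == i).
    have er : reflection I (al i) x = comb (fun i => (c' i)%:~R) t.
      rewrite reflE em {1}ex comb_sub /comb; congr (_ + _).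
      apply: eq_bigr => k _; congr (_ *: _); rewrite /c' intrB.
      by case: (k == i).
    have c'j k : k != i -> c' k = c k by move=> /negPf ki; rewrite /c' ki subr0.
    have c'i : c' i = c i - m by rewrite /c' eqxx.
    have sc' : same_sign c'.
      have [d [u [/[dup]e]]] := base_sign B Sr.
      rewrite er => /comb_inj[ecd _] sd.
      have {}ecd k : c' k = d k by apply/(intr_inj (R := R))/ecd.
      by case: sd => h; [left|right] => k; rewrite ecd.
    (* The nonzero coefficient at [j] is unchanged, so the reflected root keeps its sign, and the
       coefficient at [i] moves towards zero without changing sign. *)
    apply: (IH _ c' t Sr er sc'); rewrite -ltnS; apply: leq_ltn_trans lN.
    rewrite (bigD1 i) //= [in leqRHS](bigD1 i) //=.
    rewrite (eq_bigr (fun k => `|c k|%N)) => [|k /c'j -> //].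
    rewrite ltn_add2r; move: (c'j _ ji) => cjj; clear -cm c'i cj sc sc' cjj.
    case: sc sc' => h [] h'; move: (h i) (h' i) (h j) (h' j); rewrite c'i cjj;
      nia.
  have c0 j : j != i -> c j = 0.
    move=> ji; apply/eqP/contraT => cj; case: nj; exists j; exact/andP.
  have exi : x = (c i)%:~R *: al i + t *: a.
    by rewrite ex (combZ (i := i)) // => j /c0 ->.
  have ci0 : c i != 0 by apply: contraTneq cm => ->; rewrite mul0r.
  have ciR : (c i)%:~R != 0 :> R by rewrite intr_eq0.
  have [z ez] := mers_int M Sx (base_S B i).
  have czi : c i * z = 2.
    apply: (intr_inj (R := R)); rewrite intrM -ez exi cart_a cart_scalel //.
    by rewrite cartxx ?mers_nz ?mulrA ?mulfV ?mul1r //; apply: base_S.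
  have : c i = 1 \/ c i = 2 \/ c i = -1 \/ c i = -2.
    have : (`|c i| %| 2)%N by apply/dvdnP; exists `|z|%N; lia.
    rewrite dvdn_divisors // inE /= !inE; lia.
  have rx : reflection I (al i) x = (- (c i)%:~R) *: al i + t *: a.
    rewrite exi reflE cart_ar cartZr cartxx ?mers_nz //; last exact: base_S.
    vring.
  case=> [e|[e|[e|e]]]; move: rx exi; rewrite e => rx exi.
  - by apply: (Q1 i _ t) => //; rewrite exi scale1r.
  - exact: (Q2 i _ t).
  - apply: (QN i) => //; apply: (Q1 i _ t); first exact: mers_refl (base_S B i) Sx.
    by rewrite rx mulrNz opprK scale1r.
  - apply: (QN i) => //; apply: (Q2 i _ t); first exact: mers_refl (base_S B i) Sx.
    by rewrite rx mulrNz opprK.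
move=> x Sx; have [c [t [ex sc]]] := base_sign B Sx.
exact: (main _ _ _ _ Sx ex sc (ltnSn _)).
Qed.

(** Connectedness of the diagram, phrased as an induction principle. If [P] were closed under
    adjacency but not everything, the roots with support in [P] and those with support outside would
    be orthogonal and, by [root_ind], exhaust [S], against (R5). *)
Lemma base_conn (P : 'I_n -> Prop) :
  (exists i, P i) -> (forall i j, P i -> A i j != 0 -> P j) -> forall j, P j.
Proof.
move=> [i0 Pi0] Pc j; apply: contrapT => nPj.
pose T (P : 'I_n -> Prop) x := exists c t, x = comb c t /\ forall i, ~ P i -> c i = 0.
have Tr (P' : 'I_n -> Prop) x i :
    (P' i \/ cart (al i) x = 0) -> T P' x -> T P' (reflection I (al i) x).
  case=> [P'i|e] [c [t [e' h]]]; last by exists c, t; rewrite reflE e scale0r subr0.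
  exists (fun j => c j - cart (al i) x *+ (j == i)), t.
  rewrite reflE {1}e' comb_sub; split=> // k nk.
  by rewrite h //; case: eqP nk => [-> //|_ _]; rewrite mulr0n subr0.
have A0 i k : P i -> ~ P k -> A i k = 0.
  by move=> Pi nPk; apply/eqP/contraT => /(Pc _ _ Pi).
have TO x y : T P x -> T (fun i => ~ P i) y -> I x y = 0.
  move=> [c [t [-> hc]]] [d [u [-> hd]]]; rewrite form_comb big1 // => i _.
  have [Pi|nPi] := pselect (P i); last by rewrite hc ?mul0r.
  rewrite formC form_comb big1 ?mulr0 // => k _.
  have [Pk|nPk] := pselect (P k); first by rewrite hd ?mul0r // => /(_ Pk).
  by rewrite (formC I) A0 ?mulr0.
have Tal (P' : 'I_n -> Prop) i t : P' i -> T P' (al i + t *: a).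
  move=> P'i; exists (fun j => (j == i)%:R), t; rewrite -comb1; split=> // k nk.
  by case: eqP nk => // ->.
have TZ (P' : 'I_n -> Prop) i m t : P' i -> T P' (m *: al i + t *: a).
  move=> P'i; exists (fun j => m *+ (j == i)), t.
  rewrite (combZ (i := i)) ?eqxx; first by split=> // k nk; case: eqP nk => // ->.
  by move=> k /negPf ->.
have cov x : S x -> T P x \/ T (fun i => ~ P i) x.
  move=> Sx; pattern x; apply: root_ind Sx => [i y t _ ->|i y t _ ->|i y Sy].
  - by have [Pi|nPi] := pselect (P i); [left|right]; apply: Tal.
  - by have [Pi|nPi] := pselect (P i); [left|right]; apply: TZ.
  have alT (P' : 'I_n -> Prop) : P' i -> T P' (al i).
    by move=> P'i; rewrite -[al i]addr0 -(scale0r a); apply: Tal.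
  case=> Ty; [left|right]; apply: Tr => //.
    have [Pi|nPi] := pselect (P i); [by left|right].
    by rewrite /cart [I (al i) y]formC [I y _](TO _ _ Ty) ?mulr0 //;
      apply: (alT (fun k => ~ P k)).
  have [Pi|nPi] := pselect (P i); [right|by left].
  by rewrite /cart [I _ y]TO ?mulr0 //; apply: (alT P).
have [] := mers_irr M (S1 := S `&` T P) (S2 := S `&` T (fun i => ~ P i)).
- apply/seteqP; split=> x; last by case=> -[].
  by move=> Sx; case: (cov x Sx) => Tx; [left|right].
- apply/seteqP; split=> // x [[Sx T1] [_ T2]].
  by move: (mers_nz M Sx); rewrite (TO _ _ T1 T2) eqxx.
- by move=> x y [_ T1] [_ T2]; apply: TO.
- move/seteqP=> [h _]; apply: (h (al i0)); split; first exact: base_S.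
  by rewrite -[al i0]addr0 -(scale0r a); apply: Tal.
- move/seteqP=> [h _]; apply: (h (al j)); split; first exact: base_S.
  by rewrite -[al j]addr0 -(scale0r a); apply: Tal.
Qed.

End Base.
End RootDatum.

(** * Counting numbers and null vectors *)

Section Fibre.
Variables (R : realType) (F : vectType R) (I : {symmetric F}).
Variables (S : set F) (a : F).
Local Notation cart := (cart I).
Hypothesis M : mers I S a.
Variables (n : nat) (al : 'I_n -> F).
Hypothesis B : base S a al.
Local Notation A i j := (I (al i) (al j)).
Local Notation comb := (comb a al).
Local Notation kk := (counting_number S a).

Lemma combD0 c d : comb c 0 - comb d 0 = comb (fun i => c i - d i) 0.
Proof.
rewrite /comb !scale0r !addr0 -sumrB.
by apply: eq_bigr => i _; rewrite scalerBl.
Qed.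

Lemma cart_alal i : cart (al i) (al i) = 2.
Proof. by rewrite cartxx ?(mers_nz M) //; apply: (base_S B). Qed.

(** The reflection in [2 al_i + t a] sends [al_i] to [-(al_i + t a)]. *)
Lemma double_root_fib i t : S (2 *: al i + t *: a) -> S (al i + t *: a).
Proof.
move=> Sx; have := mers_opp M (mers_refl M Sx (base_S B i)).
rewrite reflE (cart_a M) cart_scalel ?pnatr_eq0 // cart_alal mulVf ?pnatr_eq0 //.
by congr S; vring.
Qed.

(** Otherwise [root_ind] puts all roots into the span of the [al i], hence also [a], which lies in
    the group generated by [S]; but [a] is independent of the [al i]. *)
Lemma simple_fib : exists i t, t != 0 /\ S (al i + t *: a).
Proof.
apply: contrapT => /forallNP h.
have {}h i t : S (al i + t *: a) -> t = 0.
  by move=> Sx; apply/eqP/contraT => nt; case: (h i); exists t.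
have all x : S x -> exists c, x = comb c 0.
  move=> Sx; pattern x.
  apply: (root_ind M B) Sx => [i y t Sy e|i y t Sy e|i y Sy [c e]].
  - have /h t0 : S (al i + t *: a) by rewrite -e.
    by exists (fun j => (j == i)%:R); rewrite -comb1 e t0.
  - have /double_root_fib/h t0 : S (2 *: al i + t *: a) by rewrite -e.
    exists (fun j => 2 *+ (j == i)).
    rewrite (@combZ _ _ a _ al i) ?eqxx ?e ?t0 //.
    by move=> k /negPf ->.
  - exists (fun j => c j - cart (al i) y *+ (j == i)).
    by rewrite -comb_sub reflE -e.
have [] : [set x | exists c, x = comb c 0] a.
  apply: (mers_gen M); split=> //; split=> [|x y [c ->] [d ->]].
    by exists (fun=> 0); rewrite /comb scale0r big1 ?addr0 // => i; rewrite scale0r.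
  by exists (fun i => c i - d i); apply: combD0.
move=> c ea; have e0 : comb (fun=> 0) 1 = comb c 0.
  by rewrite -ea /comb big1 ?add0r ?scale1r // => i; rewrite scale0r.
by have [_ /eqP] := comb_inj B e0; rewrite oner_eq0.
Qed.

Lemma root_fib x : S x -> exists2 t, t != 0 & S (x + t *: a).
Proof.
have sf : forall j, exists2 t, t != 0 & S (al j + t *: a).
  apply: (base_conn M B) => [|i j [t t0 St] nz].
    by have [i [t [t0 St]]] := simple_fib; exists i, t.
  exists (t * cart (al i) (al j)); last first.
    by apply: (mers_shift M (x := al i)) => //; apply: (base_S B).
  by rewrite mulf_neq0 // /cart !mulf_neq0 ?invr_neq0 ?(mers_nz M) ?pnatr_eq0 //;
    apply: (base_S B).
move=> Sx; pattern x; apply: (root_ind M B) Sx => [i y t Sy e|i y t Sy e|i y Sy].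
- have [u u0 Su] := sf i; exists (u * 2); first by rewrite mulf_neq0 ?pnatr_eq0.
  rewrite -(cart_alal i) -(cart_ar M _ _ t) -e; apply: (mers_shift M _ Su Sy).
  exact: (base_S B).
- have [u u0 Su] := sf i; exists (u * (2 * 2)); first by rewrite !mulf_neq0 ?pnatr_eq0.
  rewrite -{2}(cart_alal i) -cartZr -(cart_ar M _ _ t) -e.
  by apply: (mers_shift M _ Su Sy); exact: (base_S B).
- case=> t t0 St; exists t => //.
  have := mers_refl M (base_S B i) St.
  by rewrite !reflE (cart_ar M) addrAC.
Qed.

Lemma fib_mirror x s t : S (x + s *: a) -> S (x + t *: a) ->
  S (x + (2 * s - t) *: a).
Proof.
move=> Ss St; have := mers_opp M (mers_refl M Ss St).
have xnz : I x x != 0.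
  by have := mers_nz M Ss; rewrite (form_shift M).
rewrite reflE (cart_a M) (cart_ar M) cartxx //.
by congr S; vring.
Qed.

Lemma kkP x : S x -> (0 < kk x)%N /\
  forall t, S (x + t *: a) <-> exists m : int, t = (kk x)%:R * m%:~R.
Proof.
move=> Sx.
have Sx0 : S (x + 0 *: a) by rewrite scale0r addr0.
have SN t : S (x + t *: a) -> S (x + (- t) *: a).
  by move=> /(fib_mirror Sx0); rewrite mulr0 sub0r.
have ex : exists k, (0 < k)%N && `[< S (x + a *+ k) >].
  have [t t0 St] := root_fib Sx; have [z ez] := mers_fib M Sx St.
  exists `|z|%N; apply/andP; split.
    by rewrite absz_gt0; apply: contraNneq t0 => z0; rewrite ez z0.
  apply/asboolP; rewrite -scaler_nat natr_absz.
  case: (ler0P z) => _; last by rewrite -ez.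
  by rewrite intrN -ez; apply: SN.
have [kpos Sk kmin] : [/\ (0 < kk x)%N, S (x + a *+ kk x)
    & forall j, (0 < j)%N -> S (x + a *+ j) -> (kk x <= j)%N].
  rewrite /counting_number.
  have [k /andP[k0 /asboolP Sk] km] := ex_minnP ex.
  apply: (@xgetPex _ 0%N [set k | [/\ (0 < k)%N, S (x + a *+ k)
    & forall j, (0 < j)%N -> S (x + a *+ j) -> (k <= j)%N]]).
  exists k; split=> // j j0 Sj; apply: km; rewrite j0; exact/asboolP.
split=> // t; set k := kk x in kpos Sk kmin *.
have Skt : S (x + k%:R *: a) by rewrite scaler_nat.
(* The mirrors at [0] and at [k] compose to a translation by [2k] only; division is therefore by
   [2k], and the odd multiples of [k] start from [k] itself. *)
have S2 t' : S (x + t' *: a) -> S (x + (t' + 2 * k%:R) *: a).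
  by move=> St; have := fib_mirror Skt (SN _ St); rewrite opprK [2 * _ + _]addrC.
have S2N t' : S (x + t' *: a) -> S (x + (t' - 2 * k%:R) *: a).
  by move=> St; have := SN _ (S2 _ (SN _ St)); rewrite opprD opprK.
have S2z t' (z : int) : S (x + t' *: a) -> S (x + (t' + 2 * k%:R * z%:~R) *: a).
  move=> St; elim: z => [|m IH|m IH]; first by rewrite mulr0 addr0.
    move: (S2 _ IH); congr S; congr (_ + _ *: _).
    by rewrite -[m.+1]addn1 PoszD intrD; ring.
  move: (S2N _ IH); congr S; congr (_ + _ *: _).
  by rewrite -[m.+1]addn1 PoszD !intrN intrD; ring.
split.
  move=> St; have [z ez] := mers_fib M Sx St.
  have [q [r [eq r0 rk]]] : exists q r, [/\ z = q * (2 * k%:Z) + r, 0 <= r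
      & r < 2 * k%:Z].
    exists (divz z (2 * k%:Z)), (modz z (2 * k%:Z)).
    have k20 : 2 * k%:Z != 0 by lia.
    have := ltz_mod z k20; have := modz_ge0 z k20; rewrite -divz_eq => -> h.
    by split=> //; lia.
  have Sr : S (x + r%:~R *: a).
    move: (S2z _ (- q) St); congr S; congr (_ + _ *: _).
    by rewrite ez eq intrD !intrM intrN /=; ring.
  have Sr' : S (x + a *+ `|r|%N).
    by rewrite -scaler_nat natr_absz ger0_norm.
  have Sr2 : S (x + a *+ absz (2 * k%:Z - r)%R).
    rewrite -scaler_nat natr_absz ger0_norm; last by lia.
    by move: (fib_mirror Skt Sr); congr S; congr (_ + _ *: _); rewrite intrB intrM;
      ring.
  have [r00|rn0] := eqVneq r 0.
    by exists (2 * q); rewrite ez eq r00 addr0 !intrM; ring.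
  (* The mirror at [k] exchanges [r] and [2k - r]; both are at least [k] by minimality, so
     [r = k]. *)
  have l1 := kmin _ _ Sr'; have l2 := kmin _ _ Sr2.
  have er : r = k%:Z by lia.
  by exists (2 * q + 1); rewrite ez eq er !(intrD, intrM); ring.
case=> m ->.
have [q eq] : exists q, m = q * 2 \/ m = q * 2 + 1.
  by exists (divz m 2); lia.
case: eq => ->.
  by move: (S2z _ q Sx0); congr S; congr (_ + _ *: _); rewrite intrM; ring.
by move: (S2z _ q Skt); congr S; congr (_ + _ *: _); rewrite intrD intrM; ring.
Qed.

Lemma kk_gt0 x : S x -> 0 < (kk x)%:R :> R.
Proof. by case/kkP=> h _; rewrite ltr0n. Qed.

Lemma fibP x t : S x ->
  S (x + t *: a) <-> exists m : int, t = (kk x)%:R * m%:~R.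
Proof. by case/kkP. Qed.

Definition null_comb (c : 'I_n -> R) := forall j, \sum_i c i * A i j = 0.

(** The radical contains a vector outside the line of [a]; its coordinates are replaced by their
    absolute values. Off-diagonal entries being [<= 0], this cannot increase the norm, so the new
    vector is null too, and connectedness excludes zero coordinates. *)
Lemma null_vec : exists2 c, forall i, 0 < c i & null_comb c.
Proof.
have [v vr nva] := mers_null M.
have [c [t ev]] := base_span B v; rewrite -/(comb c t) in ev.
have [i0 ci0] : exists i, c i != 0.
  apply: contrapT => /forallNP h; move: (nva t); rewrite ev /comb big1 ?add0r ?eqxx //.
  by move=> i _; move: (h i) => /negP; rewrite negbK => /eqP ->; rewrite scale0r.
pose w := comb (fun i => `|c i|) 0.
have w0 : I w w = 0.
  apply/le_anti; rewrite (mers_pos M) andbT.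
  rewrite -[leRHS](vr v) {1}ev {1}/w !(form_comb M); apply: ler_sum => i _.
  rewrite ev ![I (al i) _]formC !(form_comb M) !big_distrr /=.
  apply: ler_sum => j _; have [->|nij] := eqVneq j i.
    by rewrite !mulrA -normrM ger0_norm // -expr2 sqr_ge0.
  rewrite !mulrA -normrM; have := form_le0 M B nij.
  have := ler_norm (c i * c j); nra.
have null : null_comb (fun i => `|c i|).
  by move=> j; rewrite -(form_comb M _ _ 0); apply: (null_rad M).
exists (fun i => `|c i|) => //.
apply: (base_conn M B) => [|i j ci nz]; first by exists i0; rewrite normr_gt0.
rewrite lt_neqAle normr_ge0 andbT; apply/eqP => cj.
move: (null j) => /eqP; rewrite (bigD1 i) //=; apply/negP.
have ij : i != j by apply: contraTneq ci => ->; rewrite -cj ltxx.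
have Aij : A i j < 0 by rewrite lt_neqAle nz (form_le0 M B).
rewrite lt_eqF //; apply: (@lt_le_trans _ _ 0) => //.
rewrite -[ltRHS]addr0; apply: ltr_leD; first by rewrite pmulr_rlt0.
apply: sumr_le0 => k _; have [->|nkj] := eqVneq k j; first by rewrite -cj mul0r.
by have := form_le0 M B nkj; have := normr_ge0 (c k); nra.
Qed.

Lemma null_combB c d t : null_comb c -> null_comb d ->
  null_comb (fun i => c i - t * d i).
Proof.
move=> nc nd j; under eq_bigr do rewrite mulrBl -mulrA.
by rewrite sumrB -big_distrr /= nc nd mulr0 subr0.
Qed.

(** At a vertex with coefficient zero the null relation is a sum of terms [<= 0], so the
    coefficients of all neighbours vanish as well. *)
Lemma null_nonneg c : null_comb c -> (forall i, 0 <= c i) ->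
  (exists i, c i = 0) -> forall i, c i = 0.
Proof.
move=> nc c0 ex; apply: (base_conn M B) => // i j ci nz.
have le0 k : c k * A k i <= 0.
  have [->|ki] := eqVneq k i; first by rewrite ci mul0r.
  by have := form_le0 M B ki; have := c0 k; nra.
have /eqP : \sum_k - (c k * A k i) = 0 by rewrite sumrN nc oppr0.
rewrite psumr_eq0 => [/allP/(_ j)|k _]; last by rewrite oppr_ge0.
by rewrite mem_index_enum oppr_eq0 mulf_eq0 formC (negPf nz) orbF => /(_ isT)/eqP.
Qed.

Lemma null_unique c d : (forall i, 0 < d i) -> null_comb d -> null_comb c ->
  exists t, forall i, c i = t * d i.
Proof.
move=> d0 nd nc.
have [i0|no] := pselect (exists i : 'I_n, True); last first.
  by exists 0 => i; case: no; exists i.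
case: i0 => i0 _.
(* Subtracting the least ratio times [d] leaves a nonnegative null combination that vanishes at
   [i]. *)
pose i := [arg min_(i < i0) (c i / d i)]%O.
have imin j : c i / d i <= c j / d j.
  by rewrite /i; case: arg_minP => // k _; apply.
exists (c i / d i) => j; apply/eqP; rewrite -subr_eq0; apply/eqP; move: j.
apply: (@null_nonneg (fun j => c j - c i / d i * d j)).
- exact: null_combB.
- by move=> j; rewrite subr_ge0 -ler_pdivlMr.
- by exists i; rewrite divfK ?subrr // gt_eqF.
Qed.

Lemma ind_card : exists i : 'I_n, True.
Proof. by have [i _] := simple_fib; exists i. Qed.

End Fibre.

(** * Data determined by the Cartan matrix *)

Section CartanMatrix.
Variables (R : realType) (F : vectType R) (I : {symmetric F}).
Variables (S : set F) (a : F).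
Local Notation cart := (cart I).
Hypothesis M : mers I S a.
Variables (n : nat) (al : 'I_n -> F).
Hypothesis B : base S a al.
Local Notation A i j := (I (al i) (al j)).
Local Notation null := (null_comb I al).

(** Divided by half the squared lengths, the null relations have integer coefficients. The rank of
    such a matrix is the same over [rat] and over [R], so there is a rational null vector;
    denominators are cleared, and [null_unique] gives all coordinates one sign. *)
Lemma null_int_vec : exists2 x : 'I_n -> int, forall i, 0 < x i
  & null (fun i => (x i)%:~R).
Proof.
have [C HC] : {C : 'I_n * 'I_n -> int &
    forall p, cart (al p.1) (al p.2) = (C p)%:~R}.
  apply: (choice (P := fun p z => cart (al p.1) (al p.2) = z%:~R)) => p.
  by apply: (mers_int M); exact: (base_S B).
have [c c0 nc] := null_vec M B.
have nullC x : null x <-> forall j, \sum_i x i * (C (j, i))%:~R = 0.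
  have e j : \sum_i x i * A i j = A j j / 2 * \sum_i x i * (C (j, i))%:~R.
    rewrite big_distrr /=; apply: eq_bigr => i _; rewrite -HC /cart.
    by rewrite (formC I (al j) (al i)); field; apply: lt0r_neq0 (base_gt0 M B _).
  have nz j : A j j / 2 != 0 by rewrite gt_eqF // divr_gt0 // (base_gt0 M B).
  split=> h j; last by rewrite e h mulr0.
  by move: (h j) => /eqP; rewrite e mulf_eq0 (negPf (nz j)) => /eqP.
pose Q : 'M[rat]_n := \matrix_(i, j) (C (j, i))%:~R.
have Qnf : ~~ row_free Q.
  apply/negP => fQ; have fR : row_free (map_mx (ratr : rat -> R) Q).
    by move: fQ; rewrite /row_free mxrank_map.
  have : (\row_i c i) *m map_mx (ratr : rat -> R) Q = 0.
    apply/rowP => j; rewrite !mxE -[RHS]((nullC c).1 nc j).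
    by apply: eq_bigr => i _; rewrite !mxE ratr_int.
  move/eqP; rewrite mulmx_free_eq0 // => /eqP/rowP e.
  have [i _] := ind_card M B.
  by move: (e i) (c0 i); rewrite !mxE => ->; rewrite ltxx.
have [v /sub_kermxP vQ vn0] : exists2 v : 'rV_n, (v <= kermx Q)%MS & v != 0.
  by apply/rowV0Pn; rewrite kermx_eq0.
pose D := \prod_i denq (v 0 i).
have D0 : D != 0 by apply/prodf_neq0 => i _; apply: denq_neq0.
have [x Hx] : {x : 'I_n -> int & forall i, (x i)%:~R = v 0 i * D%:~R}.
  apply: (choice (P := fun i y => y%:~R = v 0 i * D%:~R)) => i.
  exists (numq (v 0 i) * \prod_(j | j != i) denq (v 0 j)).
  by rewrite intrM numqE /D [in RHS](bigD1 i) //= [in RHS]intrM mulrA.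
have nx : null (fun i => (x i)%:~R).
  apply/nullC => j; transitivity (ratr (\sum_i (x i)%:~R * (C (j, i))%:~R) : R).
    by rewrite rmorph_sum; apply: eq_bigr => i _; rewrite rmorphM /= !ratr_int.
  suff -> : \sum_i (x i)%:~R * (C (j, i))%:~R = 0 :> rat by rewrite rmorph0.
  under eq_bigr => i _ do rewrite Hx mulrAC.
  rewrite -big_distrl /=; move/rowP: vQ => /(_ j); rewrite !mxE => e.
  by under eq_bigr do rewrite -[_%:~R](mxE matrix_key (fun i j => (C (j, i))%:~R));
    rewrite e mul0r.
have [t ht] := null_unique M B c0 nc nx.
have t0 : t != 0.
  apply: contraNneq vn0 => t0; apply/eqP/rowP => i; rewrite mxE.
  have : (x i)%:~R = 0 :> R by rewrite ht t0 mul0r.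
  move/eqP; rewrite intr_eq0 => /eqP xi; move: (Hx i) => /eqP.
  by rewrite xi eq_sym mulf_eq0 intr_eq0 (negPf D0) orbF => /eqP.
case: (ltP 0 t) => [tp|tn].
  by exists x => // i; rewrite -(ltr0z R) ht mulr_gt0.
exists (fun i => - x i) => [i|j].
  rewrite -(ltr0z R) intrN ht oppr_gt0 pmulr_llt0 // lt_neqAle t0 tn //.
by under eq_bigr do rewrite intrN mulNr; rewrite sumrN nx oppr0.
Qed.

Definition null_gen (d : 'I_n -> nat) :=
  [/\ forall i, (0 < d i)%N, null (fun i => (d i)%:R)
    & forall x : 'I_n -> int, null (fun i => (x i)%:~R) ->
        exists z : int, forall i, x i = z * d i].

(** The generator is a positive integral null vector with least coordinate at [i0]. Dividing another
    one by it leaves a null remainder whose coordinate at [i0] is smaller, hence zero, and then the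
    whole remainder is zero. *)
Lemma null_gen_ex : exists d, null_gen d.
Proof.
have [i0 _] := ind_card M B.
have ex : exists k : nat, `[< exists d : 'I_n -> nat,
    [/\ forall i, (0 < d i)%N, null (fun i => (d i)%:R) & d i0 = k] >].
  have [x x0 nx] := null_int_vec.
  exists `|x i0|%N; apply/asboolP; exists (fun i => `|x i|%N); split=> //.
    by move=> i; rewrite absz_gt0 gt_eqF.
  move=> j; rewrite -[RHS](nx j); apply: eq_bigr => i _.
  by rewrite natr_absz gtr0_norm.
have [k /asboolP[d [d0 nd dk]] kmin] := ex_minnP ex.
exists d; split=> // x nx; exists (divz (x i0) (d i0)) => i.
set q := divz _ _; pose y i := x i - q * d i.
have ny : null (fun i => (y i)%:~R).
  move=> j; rewrite -[RHS](null_combB q%:~R nx nd j).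
  by apply: eq_bigr => k' _; rewrite /y intrB intrM.
have [t ht] := null_unique M B (fun i => eq_ind_r is_true (d0 i) (ltr0n R (d i))) nd ny.
have di0 := d0 i0.
have yr : y i0 = modz (x i0) (d i0) by rewrite /y /q;
  have := divz_eq (x i0) (d i0); lia.
have y0 : 0 <= y i0 by rewrite yr modz_ge0 //; lia.
have yk : y i0 < d i0 by rewrite yr ltz_pmod //; lia.
have [yi0|yn0] := eqVneq (y i0) 0.
  have t0 : t = 0.
    have := ht i0; rewrite yi0 => /esym/eqP; rewrite mulf_eq0 pnatr_eq0.
    by rewrite (gtn_eqF di0) orbF => /eqP.
  have : (y i)%:~R = 0 :> R by rewrite ht t0 mul0r.
  by move/eqP; rewrite intr_eq0 subr_eq0 => /eqP.
have tp : 0 < t.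
  have : 0 < t * (d i0)%:R by rewrite -ht ltr0z lt_neqAle eq_sym yn0.
  by rewrite pmulr_lgt0 // ltr0n.
have yp j : 0 < y j by rewrite -(ltr0z R) ht mulr_gt0 // ltr0n.
have : (k <= `|y i0|)%N.
  apply: kmin; apply/asboolP; exists (fun i => `|y i|%N); split=> //.
    by move=> j; rewrite absz_gt0 gt_eqF.
  move=> j; rewrite -[RHS](ny j); apply: eq_bigr => l _.
  by rewrite natr_absz gtr0_norm.
move: yk y0; rewrite dk; lia.
Qed.

Lemma cart_mul i j : cart (al i) (al j) * A i i = cart (al j) (al i) * A j j.
Proof. by rewrite !(cart_form M) ?(formC I (al i)) //; exact: (base_S B). Qed.

Lemma cart_neq0 i j : (cart (al i) (al j) == 0) = (A i j == 0).
Proof.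
have := base_gt0 M B i; rewrite /cart => h.
by rewrite mulf_eq0 mulf_eq0 pnatr_eq0 invr_eq0 (gt_eqF h).
Qed.

(** The squared lengths of neighbours have as ratio a quotient of Cartan integers, and connectedness
    spreads this to all; [u] absorbs the product of the denominators. The existence of [form_scale]
    rests on this. *)
Lemma length_ratio : exists (u : R) (z : 'I_n -> nat),
  [/\ 0 < u, forall i, (0 < z i)%N & forall i, A i i = u * (z i)%:R].
Proof.
have [i0 _] := ind_card M B.
have : forall j, exists p : nat * nat, [/\ (0 < p.1)%N, (0 < p.2)%N
    & A j j * p.2%:R = A i0 i0 * p.1%:R].
  apply: (base_conn M B) => [|i j [[p q] /= [p0 q0 e]] nz].
    by exists i0, (1, 1)%N.
  have [y ey] := mers_int M (base_S B i) (base_S B j).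
  have [y' ey'] := mers_int M (base_S B j) (base_S B i).
  have y0 : y != 0 by rewrite -(intr_eq0 R) -ey cart_neq0.
  have y'0 : y' != 0 by rewrite -(intr_eq0 R) -ey' cart_neq0 formC.
  have := cart_mul i j; rewrite ey ey' => eyy.
  exists (p * `|y|, q * `|y'|)%N => /=.
  rewrite !muln_gt0 p0 q0 !absz_gt0 y0 y'0; split=> //.
  have h : `|y|%:~R * A i i = `|y'|%:~R * A j j :> R.
    have : `|y%:~R * A i i| = `|y'%:~R * A j j| by rewrite eyy.
    by rewrite !normrM !(gtr0_norm (base_gt0 M B _)) -!intr_norm.
  rewrite !natrM !natr_absz [RHS]mulrA -e.
  transitivity (q%:R * (`|y'|%:~R * A j j)); first by ring.
  by rewrite -h; ring.
move/choice => [f Hf].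
pose Q := (\prod_j (f j).2)%N.
have Q0 : (0 < Q)%N by rewrite prodn_gt0 // => j; case: (Hf j).
exists (A i0 i0 / Q%:R), (fun i => (f i).1 * \prod_(j | j != i) (f j).2)%N; split.
- by rewrite divr_gt0 ?ltr0n // (base_gt0 M B).
- move=> i; rewrite muln_gt0; case: (Hf i) => -> _ _ /=.
  by rewrite prodn_cond_gt0 // => j _; case: (Hf j).
move=> i; case: (Hf i) => p0 q0 e.
have eQ : Q = ((f i).2 * \prod_(j | j != i) (f j).2)%N by rewrite /Q (bigD1 i).
have q'0 : (\prod_(j | j != i) (f j).2)%:R != 0 :> R.
  by rewrite pnatr_eq0 -lt0n prodn_cond_gt0 // => j _; case: (Hf j).
have q0R : (f i).2%:R != 0 :> R by rewrite pnatr_eq0 -lt0n.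
rewrite eQ !natrM; move: e q'0 q0R; set x := _%:R; set y := (\prod_(_ | _) _)%:R.
move=> e q'0 q0R; apply: (mulIf q0R); rewrite e; field; by rewrite q'0 q0R.
Qed.

End CartanMatrix.

(** The normalisation of [I_R] for any family of squared lengths. Taking the simple roots as the
    family, as [form_scaleP] permits, ties the scale to the Gram matrix. *)
Definition normalising (R : realType) (J : Type) (L : J -> R) (c : R) :=
  [/\ 0 < c, forall i, exists z : int, c * L i = z%:~R
    & is_gcd [set z | exists i, c * L i = z%:~R] 2].

Lemma normalising_ex (R : realType) n (u : R) (z : 'I_n -> nat) (i0 : 'I_n) :
  0 < u -> (forall i, (0 < z i)%N) ->
  exists c, normalising (fun i => u * (z i)%:R) c.
Proof.
move=> u0 z0; pose g := \big[gcdn/0%N]_i z i.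
have gz i : (g %| z i)%N by rewrite /g (bigD1 i) //= dvdn_gcdl.
have g0 : (0 < g)%N by apply: (dvdn_gt0 (z0 i0)).
have g0R : g%:R != 0 :> R by rewrite pnatr_eq0 -lt0n.
have u0' : u != 0 by rewrite gt_eqF.
have e i : 2 / (u * g%:R) * (u * (z i)%:R) = (2 * (z i %/ g)%N%:Z)%:~R.
  have -> : (z i)%:R = (z i %/ g)%N%:R * g%:R :> R by rewrite -natrM divnK.
  by rewrite intrM; field; rewrite g0R u0'.
exists (2 / (u * g%:R)); split.
- by rewrite !(divr_gt0, mulr_gt0) ?ltr0n.
- by move=> i; exists (2 * (z i %/ g)%N%:Z).
split=> //.
  by move=> y [i]; rewrite e => /intr_inj <-; rewrite dvdz_mulr.
move=> y h; have {}h i : (y %| 2 * (z i %/ g)%N%:Z)%Z by apply: h; exists i.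
have {}h i : (`|y| * g %| 2 * z i)%N.
  have := h i; rewrite -(divnK (gz i)) mulnA dvdn_pmul2r //.
  by rewrite divnK // dvdzE abszM.
have : (`|y| * g %| 2 * g)%N.
  rewrite /g; suff : (`|y| * g %| \big[gcdn/0]_i (2 * z i))%N.
    congr (_ %| _)%N; rewrite (big_morph (muln 2) (id1 := 0%N) (op1 := gcdn)) //.
    by move=> x x'; rewrite muln_gcdr.
  by elim/big_rec: _ => [|i x _ IH]; rewrite ?dvdn0 // dvdn_gcd h.
by rewrite dvdn_pmul2r.
Qed.

(** Let [q / p] be the reduced ratio of the two normalised lengths at [i0]. Then [q] divides all
    values of the first family and [p] all values of the second, so both divide 2. If one were 1 and
    the other 2, all values of one family would be multiples of 4. *)
Lemma normalising_unique (R : realType) (J J' : Type) (L : J -> R) (L' : J' -> R)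
    (f : J -> J') (g : J' -> J) (s c c' : R) (i0 : J) :
  cancel g f -> (forall i, 0 < L i) -> (forall i, L' (f i) = s * L i) -> 0 < s ->
  normalising L c -> normalising L' c' ->
  forall i, c * L i = c' * L' (f i).
Proof.
move=> gK L0 eL s0 [c0 ic [_ d2 g2]] [c'0 ic' [_ d2' g2']].
have [x0 ex0] := ic i0; have [y0 ey0] := ic' (f i0).
have xp : 0 < x0 by rewrite -(ltr0z R) -ex0 mulr_gt0.
have yp : 0 < y0 by rewrite -(ltr0z R) -ey0 eL !mulr_gt0.
pose h := gcdn `|x0| `|y0|.
have h0 : (0 < h)%N by rewrite gcdn_gt0; lia.
pose q := (`|x0| %/ h)%N; pose p := (`|y0| %/ h)%N.
have ex : x0 = (q * h)%N :> int by rewrite /q divnK ?dvdn_gcdl //; lia.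
have ey : y0 = (p * h)%N :> int by rewrite /p divnK ?dvdn_gcdr //; lia.
have cpq : coprime p q.
  rewrite /coprime -(eqn_pmul2r h0) muln_gcdl mul1n.
  by rewrite !divnK ?dvdn_gcdl ?dvdn_gcdr // gcdnC.
have key i x y : c * L i = x%:~R -> c' * L' (f i) = y%:~R -> y * q%:Z = p%:Z * x.
  move=> exi eyi; apply: (intr_inj (R := R)); rewrite !intrM -exi -eyi.
  have h0R : h%:R != 0 :> R by rewrite pnatr_eq0 -lt0n.
  have : c * L i0 = q%:R * h%:R by rewrite ex0 ex -natrM.
  have : c' * L' (f i0) = p%:R * h%:R by rewrite ey0 ey -natrM.
  rewrite !eL => e1 e2.
  have e3 : c' * s * q%:R = p%:R * c.
    have Li0 : L i0 * h%:R != 0 by apply: mulf_neq0 => //; rewrite gt_eqF.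
    apply: (mulIf Li0).
    transitivity (c' * (s * L i0) * (q%:R * h%:R)); first by ring.
    by rewrite e1 -e2; ring.
  transitivity (c' * s * q%:R * L i); first by ring.
  by rewrite e3; ring.
have q0 : (0 < q)%N by lia.
have p0 : (0 < p)%N by lia.
have qx i x : c * L i = x%:~R -> (q %| x)%Z.
  move=> exi; have [y eyi] := ic' (f i).
  have : (q %| p%:Z * x)%Z by rewrite -(key _ _ _ exi eyi) dvdz_mull.
  by rewrite !dvdzE abszM Gauss_dvdr // coprime_sym.
have py i y : c' * L' (f i) = y%:~R -> (p %| y)%Z.
  move=> eyi; have [x exi] := ic i.
  have : (p %| y * q%:Z)%Z by rewrite (key _ _ _ exi eyi) dvdz_mulr.
  by rewrite !dvdzE abszM Gauss_dvdl.
have dq : (q %| 2)%Z by apply: g2 => z [i]; apply: qx.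
have dp : (p %| 2)%Z.
  by apply: g2' => z [i]; rewrite -(gK i); apply: py.
have pq : p = q.
  have : p = 1%N \/ p = 2%N by move: dp; rewrite dvdzE dvdn_divisors // !inE; lia.
  have : q = 1%N \/ q = 2%N by move: dq; rewrite dvdzE dvdn_divisors // !inE; lia.
  case=> eq [] ep; rewrite ?eq ?ep //.
    have : (4 %| 2)%Z; last by [].
    apply: g2' => z [j]; rewrite -(gK j) => ez.
    have [x exi] := ic (g j); have := key _ _ _ exi ez; rewrite ep eq.
    have /dvdzP[w ->] : (2 %| x)%Z by apply: d2; exists (g j).
    by move=> e; apply/dvdzP; exists w; lia.
  have : (4 %| 2)%Z; last by [].
  apply: g2 => z [j] ez.
  have [y eyi] := ic' (f j); have := key _ _ _ ez eyi; rewrite ep eq.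
  have /dvdzP[w ->] : (2 %| y)%Z by apply: d2'; exists (f j).
  by move=> e; apply/dvdzP; exists w; lia.
move=> i; have [x exi] := ic i; have [y eyi] := ic' (f i).
rewrite exi eyi; have := key _ _ _ exi eyi; rewrite pq => e.
congr (_%:~R); nia.
Qed.

Section FormScale.
Variables (R : realType) (F : vectType R) (I : {symmetric F}).
Variables (S : set F) (a : F).
Hypothesis M : mers I S a.
Variables (n : nat) (al : 'I_n -> F).
Hypothesis B : base S a al.

Lemma root_length x : S x ->
  exists i, I x x = I (al i) (al i) \/ I x x = 4 * I (al i) (al i).
Proof.
move=> Sx; pattern x.
apply: (root_ind M B) Sx => [i y t _ ->|i y t _ ->|i y Sy [j]].
- by exists i; left; rewrite (form_shift M).
- by exists i; right; rewrite (form_shift M) !formE; ring.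
- rewrite form_refl; first by exists j.
  exact: (mers_nz M) (base_S B i).
Qed.

(** Besides the squared lengths of simple roots, only four times such values can occur among the
    roots, and these affect neither integrality nor the gcd. *)
Lemma form_scaleP : normalising (fun i => I (al i) (al i)) (form_scale I S).
Proof.
set L := fun i => _.
have eqv c : normalising L c <-> [/\ 0 < c,
    forall x, S x -> exists z : int, c * I x x = z%:~R
  & is_gcd [set z | exists2 x, S x & c * I x x = z%:~R] 2].
  split=> [[c0 ic [_ d g]]|[c0 ic [_ d g]]].
    split=> // [x /root_length[i [->|->]]|].
    - exact: ic.
    - have [z ez] := ic i; exists (4 * z).
      by rewrite intrM -ez /L; ring.
    split=> // [z [x /root_length[i [->|->]] ez]|e h].
    - by apply: d; exists i.
    - have [y ey] := ic i.
      have -> : z = 4 * y.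
        by apply: (intr_inj (R := R)); rewrite intrM -ez -ey /L; ring.
      by rewrite dvdz_mull // d //; exists i.
    apply: g => z [i ez]; apply: h; exists (al i) => //; exact: (base_S B).
  split=> // [i|]; first by apply: ic; exact: (base_S B).
  split=> // [z [i ez]|e h].
    by apply: d; exists (al i) => //; exact: (base_S B).
  apply: g => z [x /[dup] Sx /root_length[i [e1|e1]] ez].
    by apply: h; exists i; rewrite /L -e1.
  have [y ey] := ic _ (base_S B i).
  have -> : z = 4 * y by apply: (intr_inj (R := R)); rewrite intrM -ez -ey e1; ring.
  by rewrite dvdz_mull // h //; exists i.
apply/eqv; rewrite /form_scale.
apply: (@xgetPex _ 1 [set c | [/\ 0 < c,
    forall x, S x -> exists z : int, c * I x x = z%:~R
  & is_gcd [set z | exists2 x, S x & c * I x x = z%:~R] 2]]).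
have [u [z [u0 z0 e]]] := length_ratio M B; have [i0 _] := ind_card M B.
have [c hc] := normalising_ex i0 u0 z0; exists c; apply/eqv.
by have -> : L = fun i => u * (z i)%:R by apply/funext.
Qed.

End FormScale.

(** * Two systems with the same Cartan matrix *)

Section TwoSystems.
Variables (R : realType) (F1 F2 : vectType R).
Variables (I1 : {symmetric F1}) (I2 : {symmetric F2}).
Variables (S1 : set F1) (S2 : set F2) (a1 : F1) (a2 : F2).
Hypotheses (M1 : mers I1 S1 a1) (M2 : mers I2 S2 a2).
Variables (n1 n2 : nat) (al1 : 'I_n1 -> F1) (al2 : 'I_n2 -> F2).
Hypotheses (B1 : base S1 a1 al1) (B2 : base S2 a2 al2).
Variables (f : 'I_n1 -> 'I_n2) (g : 'I_n2 -> 'I_n1).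
Hypotheses (fK : cancel f g) (gK : cancel g f).
Hypothesis Hcart : forall i j,
  cart I1 (al1 i) (al1 j) = cart I2 (al2 (f i)) (al2 (f j)).

(** The symmetry [C_ij A_ii = C_ji A_jj] transports the ratio of squared lengths along the edges of
    the connected diagram. *)
Lemma gram_scale : exists2 s, 0 < s &
  forall i j, I2 (al2 (f i)) (al2 (f j)) = s * I1 (al1 i) (al1 j).
Proof.
have [i0 _] := ind_card M1 B1.
pose L1 i := I1 (al1 i) (al1 i); pose L2 i := I2 (al2 (f i)) (al2 (f i)).
have L10 i : 0 < L1 i by exact: (base_gt0 M1 B1 i).
have L20 i : 0 < L2 i by exact: (base_gt0 M2 B2 (f i)).
have Ls i : L2 i = L2 i0 / L1 i0 * L1 i.
  move: i; apply: (base_conn M1 B1) => [|i j e nz].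
    by exists i0; rewrite divfK // gt_eqF.
  have e1 := cart_mul M1 B1 i j; have e2 := cart_mul M2 B2 (f i) (f j).
  have c0 : cart I1 (al1 j) (al1 i) != 0 by rewrite (cart_neq0 M1 B1) formC.
  apply: (mulfI c0); rewrite {1}Hcart -e2 -Hcart -/(L2 i) e mulrCA e1.
  by rewrite /L1 mulrCA.
exists (L2 i0 / L1 i0) => [|i j]; first by rewrite divr_gt0.
have e1 := cart_form M1 (al1 j) (base_S B1 i).
have e2 := cart_form M2 (al2 (f j)) (base_S B2 (f i)).
have two0 : 2 != 0 :> R by rewrite pnatr_eq0.
apply: (mulfI two0); rewrite -e2 -Hcart -/(L2 i) Ls mulrCA e1; ring.
Qed.

Lemma form_scale_eq i : form_scale I1 S1 * I1 (al1 i) (al1 i) =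
  form_scale I2 S2 * I2 (al2 (f i)) (al2 (f i)).
Proof.
have [s s0 es] := gram_scale.
apply: (normalising_unique i gK _ _ s0 (form_scaleP M1 B1) (form_scaleP M2 B2)).
  by move=> j; apply: (base_gt0 M1 B1).
by move=> j; apply: es.
Qed.

Lemma null_gen_eq d1 d2 : null_gen I1 al1 d1 -> null_gen I2 al2 d2 ->
  forall i, d1 i = d2 (f i).
Proof.
move=> [p1 z1 g1] [p2 z2 g2].
have [s s0 es] := gram_scale.
have tr (x : 'I_n2 -> R) : null_comb I2 al2 x <-> null_comb I1 al1 (x \o f).
  have e j : \sum_i x i * I2 (al2 i) (al2 (f j)) =
      s * \sum_i (x \o f) i * I1 (al1 i) (al1 j).
    rewrite big_distrr (reindex f) /=; last by exists g => k _; [apply: fK|apply: gK].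
    by apply: eq_bigr => k _; rewrite es; ring.
  split=> h j; first by have /eqP := h (f j); rewrite e mulf_eq0 gt_eqF // => /eqP.
  by rewrite -(gK j) e h mulr0.
have [z hz] : exists z : int, forall i, (d2 (f i) : int) = z * d1 i.
  by apply: (g1 (fun i => d2 (f i))); exact: ((tr (fun i => (d2 i)%:R)).1 z2).
have [z' hz'] : exists z : int, forall i, (d1 (g i) : int) = z * d2 i.
  apply: (g2 (fun i => d1 (g i))); apply: (tr (fun i => (d1 (g i))%:R)).2.
  by move=> j; rewrite -[RHS](z1 j); apply: eq_bigr => k _; rewrite /= fK.
move=> i; have := hz i; have := hz' (f i); rewrite fK.
have := p1 i; have := p2 (f i); set x := d1 i; set y := d2 (f i) => y0 x0 e1 e2.
have z1' : 1 <= z by nia.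
have z1'' : 1 <= z' by nia.
by apply/eqP; rewrite eqn_leq; apply/andP; split; nia.
Qed.

End TwoSystems.

(** * Marked elliptic root systems and paired simple systems *)

Section Subgroups.
Variables (R : realType) (V : vectType R).

Lemma subgroupN (H : set V) x : subgroup H -> H x -> H (- x).
Proof. by case=> H0 HB Hx; rewrite -sub0r; apply: HB. Qed.

Lemma subgroupD (H : set V) x y : subgroup H -> H x -> H y -> H (x + y).
Proof.
by move=> sH Hx Hy; rewrite -[y]opprK; apply: sH.2 => //; apply: subgroupN.
Qed.

Lemma subgroupMz (H : set V) x (z : int) : subgroup H -> H x -> H (x *~ z).
Proof.
move=> sH Hx; have Hn m : H (x *+ m).
  by elim: m => [|m IH]; [apply: sH.1|rewrite mulrS; apply: (subgroupD sH)].
by case: z => m; [exact: Hn|exact: (subgroupN sH (Hn m.+1))].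
Qed.

Lemma subgroup_sum (H : set V) n (f : 'I_n -> V) : subgroup H ->
  (forall i, H (f i)) -> H (\sum_i f i).
Proof.
move=> sH Hf; elim/big_ind: _ => //; first exact: sH.1.
by move=> x y; apply: subgroupD.
Qed.

Lemma subgroup_genP (S : set V) : subgroup (subgroup_gen S).
Proof.
split=> [H [[]]//|x y hx hy H sH].
by apply: sH.1.2; [apply: hx|apply: hy].
Qed.

Lemma sub_subgroup_gen (S : set V) : S `<=` subgroup_gen S.
Proof. by move=> x Sx H [_]; apply. Qed.

End Subgroups.

Section Signature.
Variables (R : realType) (F : vectType R) (I : {symmetric F}).
Variables (l : nat).
Hypothesis sig : has_signature I l 2 0.

Lemma signature_pos x : 0 <= I x x.
Proof.
have [X [bX oX _ _ cn]] := sig.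
rewrite (coord_basis (X := in_tuple X) bX (memvf x)) form_suml.
apply: sumr_ge0 => i _; rewrite formZl form_sumr (bigD1 i) //= big1 => [|j ji].
  rewrite addr0 formZr mulrA -expr2 mulr_ge0 ?sqr_ge0 // leNgt.
  move/eqP: cn; rewrite eqn0Ngt -has_count => /hasPn; apply.
  by rewrite mem_nth // size_tuple.
by rewrite formZr oX ?mulr0 // eq_sym.
Qed.

Lemma signature_null a :
  exists2 v, (forall y, I v y = 0) & forall t, v != t *: a.
Proof.
have [X [bX oX _ cz _]] := sig.
pose Y := [seq x <- X | I x x == 0].
have fY : free Y by apply/filter_free/(basis_free bX).
(* The two null vectors of the orthogonal basis are independent, so they cannot both lie on one
   line. *)
have [v vY nv] : exists2 v, v \in Y & v \notin <[a]>%VS.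
  apply: contrapT => /forall2NP h.
  have : (<<Y>> <= <[a]>)%VS.
    by apply/span_subvP => v vY; case: (h v) => // /negP; rewrite negbK.
  move/dimvS; move: fY; rewrite /free => /eqP ->; rewrite size_filter cz dim_vline.
  by case: (_ != _).
exists v; last by move=> t; apply: contraNneq nv => ->; apply/vlineP; exists t.
move: vY; rewrite mem_filter => /andP[/eqP v0 vX].
have iv : (index v X < size X)%N by rewrite index_mem.
move=> y; rewrite (coord_basis (X := in_tuple X) bX (memvf y)) form_sumr.
rewrite big1 // => j _; rewrite formZr.
have [e|ne] := eqVneq (index v X) j.
  by rewrite -e nth_index // v0 mulr0.
by rewrite -{1}(nth_index 0 vX) oX ?mulr0.
Qed.

End Signature.

Section Marked.
Variables (R : realType) (F : vectType R) (I : {symmetric F}).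
Variables (S : set F) (G : {vspace F}) (a : F).
Hypothesis HM : marked_elliptic I S G.
Hypothesis Ha : generator (subgroup_gen S `&` [set x | x \in G]) a.
Local Notation proj := (quot_proj G).
Local Notation cart := (cart I).

Lemma marked_gen : subgroup_gen S a /\ a \in G.
Proof.
have : [set a *~ z | z in setT] a by exists 1.
by rewrite -Ha; case.
Qed.

Lemma marked_a0 : a != 0.
Proof.
have [_ _ _ [X [sX fX eX]]] := HM.
apply: contraTneq isT => a0.
case: X sX fX eX => [|x [|]] //= _ fX eX.
have : int_span [:: x] x.
  by exists (fun=> 1); rewrite big_ord1 /= mulr1z.
rewrite -eX Ha; case=> z _; rewrite a0 mul0rz => x0.
have := fX (fun=> 1); rewrite big_ord1 /= -x0 mul0rz.
by move=> /(_ erefl ord0).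
Qed.

Lemma marked_line : G = <[a]>%VS.
Proof.
have [_ dG _ _] := HM; have [_ aG] := marked_gen.
by apply/esym/eqP; rewrite eqEdim -memvE aG dG dim_vline marked_a0.
Qed.

Lemma markedG x : x \in G <-> exists t, x = t *: a.
Proof.
by rewrite marked_line; split=> [/vlineP//|h]; apply/vlineP.
Qed.

Lemma proj_eq x y : proj x = proj y <-> exists t, x = y + t *: a.
Proof.
rewrite quot_proj_eq markedG; split=> -[t e]; exists t.
  by rewrite -e addrC subrK.
by rewrite e addrC addKr.
Qed.

Lemma marked_mers : mers I S a.
Proof.
have [[[[S0 _] Snz Srefl Sint Sirr] [l l0 sig]] dG Grad rk] := HM.
have [ga aG] := marked_gen.
split=> //.
- exact: signature_pos sig.
- by move=> y; apply: Grad.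
- exact: signature_null sig a.
- by move=> x y Sx Sy; rewrite -(Srefl x Sx); exists y.
- by move=> x y Sx Sy; have := Sint x y Sx Sy; rewrite /coroot formZl.
- move=> x t Sx Sxt.
  have : (subgroup_gen S `&` [set x | x \in G]) (t *: a).
    split; last by apply/markedG; exists t.
    rewrite -[t *: a](addKr x) addrC; apply: (subgroup_genP S).2;
    exact: sub_subgroup_gen.
  rewrite Ha; case=> z _ e; exists z; apply/eqP.
  move/eqP: e; rewrite -scaler_int -subr_eq0 -scalerBl scaler_eq0 (negPf marked_a0).
  by rewrite orbF subr_eq0 eq_sym.
- exact: marked_a0.
Qed.

Lemma root_quotP c x : root_quot S G (c *: proj x) <->
  exists t, S (c *: x + t *: a).
Proof.
split=> [[y Sy]|[t St]].
  by rewrite -linearZ /= => /proj_eq[t e]; exists t; rewrite -e.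
by exists (c *: x + t *: a) => //; rewrite -linearZ; apply/proj_eq; exists t.
Qed.

Section Paired.
Variables (n : nat) (P : n.-tuple F * n.-tuple F).
Hypothesis HP : paired_simple_system S G a P.
Local Notation al := (tnth P.1).

Lemma paired_proj_basis : basis_of fullv [tuple of map proj P.1].
Proof. by case: HP => _ [b _ _] _ _. Qed.

Lemma nth_map_proj (i : 'I_n) : [tuple of map proj P.1]`_i = proj (al i).
Proof. by rewrite -tnth_nth tnth_map. Qed.

Lemma proj_comb (c : 'I_n -> R) : proj (\sum_i c i *: al i) = \sum_i c i *: proj (al i).
Proof. by rewrite linear_sum; apply: eq_bigr => i _; rewrite linearZ. Qed.

Lemma proj_free (c d : 'I_n -> R) :
  \sum_i c i *: proj (al i) = \sum_i d i *: proj (al i) -> c =1 d.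
Proof.
move=> e i; apply/eqP; rewrite -subr_eq0; apply/eqP; move: i.
move: (basis_free paired_proj_basis) => /freeP; apply.
under eq_bigr do rewrite nth_map_proj scalerBl.
by rewrite sumrB e subrr.
Qed.

Lemma paired_base : base S a al.
Proof.
case: (HP) => dc [b _ sgn] _ _; split.
- by move=> i; case: (dc i).
- move=> c t e.
  have : \sum_i c i *: proj (al i) = \sum_i (0 : R) *: proj (al i).
    rewrite -!proj_comb; apply/proj_eq; exists (- t).
    rewrite [X in X + _]big1 => [|i _]; last by rewrite scale0r.
    by rewrite add0r scaleNr; apply/eqP; rewrite -addr_eq0 e.
  move=> /proj_free c0; split=> //; move/eqP: e.
  rewrite big1 ?add0r => [|i _]; last by rewrite c0 scale0r.
  by rewrite scaler_eq0 (negPf marked_a0) orbF => /eqP.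
- move=> x; have := coord_basis paired_proj_basis (memvf (proj x)).
  under eq_bigr do rewrite nth_map_proj.
  set X := [tuple of _]; rewrite -(proj_comb (fun i => coord X i (proj x))).
  by move=> /proj_eq[t e]; exists (fun i => coord X i (proj x)), t.
have dc_sign x : roots_dc S x -> exists (c : 'I_n -> int) t,
    x = \sum_i (c i)%:~R *: al i + t *: a /\ same_sign c.
  move=> Sx; have [] := sgn (proj x); first by exists x.
  set X := [tuple of map proj P.1]; rewrite -/(val X).
  have sz : n = size X by rewrite size_tuple.
  move=> c [ex sc]; exists (fun i => c (cast_ord sz i)).
  have : proj x = \sum_i (c (cast_ord sz i))%:~R *: proj (al i).
    rewrite ex (reindex (cast_ord sz)) /=; last first.
      by exists (cast_ord (esym sz)) => i _; rewrite ?cast_ordK ?cast_ordKV.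
    by apply: eq_bigr => i _; rewrite scaler_int -nth_map_proj.
  rewrite -proj_comb => /proj_eq[t e]; exists t; split=> //.
  by case: sc => h; [left|right] => i; apply: h.
(* The simple system only speaks of indivisible roots. If [x / 2] is a root it is itself
   indivisible, since [x / 4] would pair with [x] to [1/2]; its coefficients are then doubled. *)
move=> x Sx; have [h|h] := pselect (S (2^-1 *: x)); last by apply: dc_sign; split.
have [] := dc_sign (2^-1 *: x).
  split=> // h4; have [z ez] := mers_int marked_mers Sx h4.
  have : cart x (2^-1 *: (2^-1 *: x)) = 2^-1.
    rewrite !cartZr cartxx ?(mers_nz marked_mers) //.
    by field.
  rewrite ez => e; have : (z * 2)%:~R = 1%:~R :> R.
    by rewrite intrM e mulVf // pnatr_eq0.
  by move/intr_inj; lia.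
move=> c [t [e sc]]; exists (fun i => 2 * c i), (2 * t); split; last first.
  by case: sc => sc; [left|right] => i; have := sc i; lia.
have -> : x = 2 *: (2^-1 *: x) by rewrite scalerA mulfV ?pnatr_eq0 // scale1r.
rewrite e scalerDr scaler_sumr scalerA; congr (_ + _).
by apply: eq_bigr => i _; rewrite intrM scalerA.
Qed.

Let M := marked_mers.
Let B := paired_base.

Lemma null_combP (x : 'I_n -> R) : null_comb I al x <->
  radical (quot_form I) (\sum_i x i *: proj (al i)).
Proof.
have qf x' y : quot_form I (proj x') (proj y) = I x' y.
  have val_proj z : exists t, vsval (proj z) = z + t *: a.
    apply/proj_eq; apply: (quot_projK (G := G)).
  rewrite /quot_form; have [t ->] := val_proj x'; have [s ->] := val_proj y.
  exact: (form_shift M).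
rewrite -proj_comb; split=> [h u|h j].
  rewrite -(quot_projK u) qf.
  have [c [t ->]] := base_span B (vsval u).
  rewrite formDr formZr (formar M) mulr0 addr0 form_sumr big1 // => i _.
  rewrite formZr form_suml -[RHS](mulr0 (c i)) -[in RHS](h i); congr (_ * _).
  by apply: eq_bigr => j _; rewrite formZl.
have := h (proj (al j)); rewrite qf form_suml => e; rewrite -[RHS]e.
by apply: eq_bigr => i _; rewrite formZl.
Qed.

Lemma root_quot_gen u : subgroup_gen (root_quot S G) u <->
  exists x : 'I_n -> int, u = \sum_i (x i)%:~R *: proj (al i).
Proof.
split=> [h|[x ->]].
  apply: (h [set u | exists x : 'I_n -> int, u = \sum_i (x i)%:~R *: proj (al i)]).
  split; last first.
    move=> _ [y Sy <-]; have [c [t [-> _]]] := base_sign B Sy; exists c.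
    by rewrite -proj_comb; apply/proj_eq; exists t.
  split=> [|y z [c ->] [d ->]].
    by exists (fun=> 0); rewrite big1 // => i _; rewrite scale0r.
  exists (fun i => c i - d i); rewrite -sumrB.
  by apply: eq_bigr => i _; rewrite intrB scalerBl.
apply: subgroup_sum => [|i]; first exact: subgroup_genP.
rewrite scaler_int; apply: subgroupMz (subgroup_genP _) _.
apply: (@sub_subgroup_gen _ _ (root_quot S G)); exists (al i) => //; exact: (base_S B).
Qed.

Lemma null_coefP (c : 'I_n -> nat) : null_gen I al c <->
  (forall i, (0 < c i)%N) /\ generator
   (subgroup_gen (root_quot S G) `&` radical (quot_form I))
   (\sum_i proj (al i) *+ c i).
Proof.
have ew : \sum_i proj (al i) *+ c i = \sum_i (c i)%:R *: proj (al i).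
  by apply: eq_bigr => i _; rewrite scaler_nat.
have ewz (z : int) : (\sum_i (c i)%:R *: proj (al i)) *~ z =
    \sum_i (z * c i)%:~R *: proj (al i).
  rewrite -scaler_int scaler_sumr; apply: eq_bigr => i _.
  by rewrite scalerA intrM.
rewrite ew; split=> [[c0 nc gc]|[c0 gc]].
  split=> //; apply/seteqP; split=> u.
    case=> /root_quot_gen[x ->] /null_combP /gc[z hz].
    by exists z => //; rewrite ewz; apply: eq_bigr => i _; rewrite hz.
  case=> z _ <-; rewrite ewz; split; first by apply/root_quot_gen;
    exists (fun i => z * c i).
  apply/null_combP => j; rewrite -[RHS](mulr0 z%:~R) -[in RHS](nc j) big_distrr /=.
  by apply: eq_bigr => i _; rewrite intrM mulrA.
split=> // [|x nx].
  apply/null_combP; set w := \sum_i _.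
  have : [set w *~ z | z in setT] w by exists 1.
  by rewrite -gc; case.
have : [set (\sum_i (c i)%:R *: proj (al i)) *~ z | z in setT]
    (\sum_i (x i)%:~R *: proj (al i)).
  by rewrite -gc; split; [apply/root_quot_gen; exists x|apply/null_combP].
case=> z _; rewrite ewz => /proj_free e; exists z => i.
by apply/(intr_inj (R := R))/esym/e.
Qed.

Lemma null_coef_gen : null_gen I al (null_coef I S G P.1).
Proof.
have [d hd] := null_gen_ex M B.
apply/null_coefP; rewrite /null_coef.
apply: (@xgetPex _ [ffun=> 0%N] [set c : {ffun 'I_n -> nat} |
  (forall i, (0 < c i)%N) /\ generator
   (subgroup_gen (root_quot S G) `&` radical (quot_form I))
   (\sum_i proj (al i) *+ c i)]).
exists (finfun d) => /=; apply/null_coefP.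
by have -> : (finfun d : 'I_n -> nat) = d by apply/funext => i; rewrite ffunE.
Qed.

End Paired.
End Marked.

(** * Exponents and doubled roots *)

Section Exponents.
Variables (R : realType) (F : vectType R) (I : {symmetric F}).
Variables (S : set F) (G : {vspace F}) (a : F).
Hypothesis HM : marked_elliptic I S G.
Hypothesis Ha : generator (subgroup_gen S `&` [set x | x \in G]) a.
Variables (n : nat) (P : n.-tuple F * n.-tuple F).
Hypothesis HP : paired_simple_system S G a P.
Local Notation proj := (quot_proj G).
Local Notation cart := (cart I).
Local Notation al := (tnth P.1).
Local Notation kk := (counting_number S a).
Local Notation C i j := (cart (al i) (al j)).
Let M : mers I S a := marked_mers HM Ha.
Let B : base S a al := paired_base HM Ha HP.

Definition knr_at i := knr S G a (al i).
Local Notation q := knr_at.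
Definition nonwhite i := exists t, S (2 *: al i + t *: a).

Lemma kk_eq x y : S x -> S y -> (forall t, S (x + t *: a) <-> S (y + t *: a)) ->
  kk x = kk y.
Proof.
move=> Sx Sy h.
have kx := kk_gt0 M B Sx; have ky := kk_gt0 M B Sy.
have [m em] : exists m : int, (kk x)%:R = (kk y)%:R * m%:~R :> R.
  by apply/(fibP M B) => //; apply/h/(fibP M B) => //; exists 1; rewrite mulr1.
have [m' em'] : exists m : int, (kk y)%:R = (kk x)%:R * m%:~R :> R.
  by apply/(fibP M B) => //; apply/h/(fibP M B) => //; exists 1; rewrite mulr1.
rewrite !ltr0n in kx ky.
have e : (kk x)%:Z = (kk y)%:Z * m by apply: (intr_inj (R := R)); rewrite intrM.
have e' : (kk y)%:Z = (kk x)%:Z * m' by apply: (intr_inj (R := R)); rewrite intrM.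
have z1' : 1 <= m by nia.
have z1'' : 1 <= m' by nia.
by apply/eqP; rewrite eqn_leq; apply/andP; split; nia.
Qed.

Lemma kk_shift x t : S x -> S (x + t *: a) -> kk (x + t *: a) = kk x.
Proof.
move=> Sx Sxt; apply: kk_eq => // u.
have [m em] := (fibP M B t Sx).1 Sxt.
rewrite -addrA -scalerDl !(fibP M B) //; split=> -[m' e].
  by exists (m' - m); rewrite intrB mulrBr -e em; ring.
by exists (m + m'); rewrite intrD mulrDr -e em.
Qed.

Lemma al_nrad i t : al i != t *: a.
Proof.
apply: contraTneq isT => e; have := base_gt0 M B i.
by rewrite e formZl (mers_rad M) mulr0 ltxx.
Qed.

(** Unfolds the two choices in [knr]: the ratio is [d^-1], and then [k] solves
    [al = al + u a - k a]. Both are unique because [al i] is not a multiple of [a] and [a] is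
    nonzero. *)
Lemma knrE i d u : d != 0 -> star S a (prime_root S G a (al i)) = d *: (al i + u *:
  a) ->
  q i = u.
Proof.
move=> d0 e; rewrite /knr_at /knr e.
have pe : proj (d *: (al i + u *: a)) = d *: proj (al i).
  by rewrite -linearZ; apply/(proj_eq HM Ha); exists (d * u); rewrite scalerDr scalerA.
have -> : quot_ratio G (al i) (d *: (al i + u *: a)) = d^-1.
  apply: xget_unique => /=; first by rewrite pe scalerA mulVf // scale1r.
  move=> c; rewrite pe scalerA => /eqP; rewrite -subr_eq0 -{1}[proj _]scale1r -scalerBl.
  rewrite scaler_eq0 subr_eq0 => /orP[/eqP cd|].
    by apply: (mulIf d0); rewrite mulVf.
  rewrite -(linear0 proj) => /eqP/(proj_eq HM Ha)[t]; rewrite add0r => /eqP.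
  by rewrite (negPf (al_nrad i t)).
rewrite scalerA mulVf // scale1r; apply: xget_unique => /=; first by rewrite addrK.
move=> k /eqP; rewrite -addrA -scalerBl -subr_eq0 opprD addNKr oppr_eq0.
by rewrite scaler_eq0 (negPf (mers_a0 M)) orbF subr_eq0 => /eqP.
Qed.

Lemma starE x : star S a x = x + (kk x)%:R *: a.
Proof. by rewrite /star scaler_nat. Qed.

Lemma white_data i : ~ nonwhite i ->
  [/\ q i = (kk (al i))%:R, prime_root S G a (al i) = al i
    & star S a (prime_root S G a (al i)) = al i + q i *: a].
Proof.
move=> nw; have pe : prime_root S G a (al i) = al i.
  by rewrite /prime_root; case: asboolP => // /(root_quotP HM Ha).
have e : q i = (kk (al i))%:R.
  by apply: (@knrE i 1); rewrite ?oner_eq0 // scale1r pe starE.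
by split=> //; rewrite pe e starE.
Qed.

Lemma nonwhite_prime i : nonwhite i ->
  prime_set S G a (al i) (prime_root S G a (al i)).
Proof.
move=> [t St]; have [z ez] := mers_fib M (base_S B i) (double_root_fib M B St).
rewrite /prime_root asboolT; last by apply/(root_quotP HM Ha); exists t.
apply: xgetPex; set y := _ + _ in St.
have k0 := kk_gt0 M B St; set k := kk y in k0; rewrite ltr0n in k0.
(* In the class of [z] modulo [k], the offset [-m] is the one in [(-k, 0]]; adding [k] makes it
   positive, as the two sign conditions on [al'] demand. *)
pose m := modz (- z) k%:Z; pose d := divz (- z) k%:Z.
have k0' : k%:Z != 0 by lia.
have m0 : 0 <= m by exact: modz_ge0.
have mk : m < k by have := ltz_mod (- z) k0'; rewrite -/m; lia.
have em : - z = d * k + m by exact: divz_eq.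
have ex : y + (k%:R * d%:~R) *: a = 2 *: al i + a *~ - m.
  rewrite /y -scaler_int -addrA -scalerDl ez; congr (_ + _ *: _).
  have -> : - m = z + k%:Z * d by lia.
  by rewrite intrD intrM.
have Sx : S (y + (k%:R * d%:~R) *: a) by apply/(fibP M B _ St); exists d.
exists (2 *: al i + a *~ - m); split=> //.
- by rewrite -ex.
- by rewrite -linearZ; apply/(proj_eq HM Ha); exists (- m)%:~R; rewrite scaler_int.
- by exists (- m) => //; lia.
exists (k%:Z - m); first by lia.
rewrite -ex starE kk_shift // ex -addrA; congr (_ + _).
by rewrite -!scaler_int -scalerDl intrB intrN addrC.
Qed.

(* The four cases are told apart by k' = d k and z = - k m, where al' = 2 al + z a
   and k' is its counting number; the pairing condition excludes (d, m) = (4, 0). *)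
Lemma nonwhite_data i : nonwhite i ->
  [/\ 0 < q i, star S a (prime_root S G a (al i)) = 2 *: (al i + q i *: a),
      (kk (al i))%:R = q i \/ (kk (al i))%:R = 2 * q i
    & (S (2 *: al i) /\ forall t, S (2 *: al i + t *: a) <->
        exists m : int, t = 2 * q i * m%:~R) \/
      (~ S (2 *: al i) /\ forall t, S (2 *: al i + t *: a) <->
        exists m : int, t = 2 * q i + 4 * q i * m%:~R)].
Proof.
move=> nw; have [Sy _ [z z0 ey] [z' z'0 esy]] := nonwhite_prime nw.
set y := prime_root _ _ _ _ in Sy ey esy *.
have Sa := base_S B i; have a0 := mers_a0 M.
have k0 := kk_gt0 M B Sa; set k := kk (al i) in k0 *.
have k'0 := kk_gt0 M B Sy; set k' := kk y in k'0.
have ey' : y = 2 *: al i + z%:~R *: a by rewrite ey scaler_int.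
have ez' : z' = z + k'%:Z.
  move: esy; rewrite starE -/k' ey' -addrA -scalerDl -scaler_int => /addrI.
  move=> /eqP; rewrite -subr_eq0 -scalerBl scaler_eq0 (negPf a0) orbF subr_eq0.
  by move=> /eqP e; apply: (intr_inj (R := R)); rewrite intrD -e.
have inn t : S (2 *: al i + t *: a) <-> exists m : int, t - z%:~R = k'%:R * m%:~R.
  rewrite -(fibP M B _ Sy) ey' -addrA -scalerDl.
  by have -> : z%:~R + (t - z%:~R) = t by rewrite addrC subrK.
have kin t : S (2 *: al i + t *: a) -> exists m : int, t = k%:R * m%:~R.
  by move=> /(double_root_fib M B)/(fibP M B _ Sa).
have [m1 em1] : exists m, z = k%:Z * m.
  have [|m em] := kin z%:~R; first by rewrite -ey'.
  by exists m; apply: (intr_inj (R := R)); rewrite em intrM.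
have [m2 em2] : exists m, z + k'%:Z = k%:Z * m.
  have [|m em] := kin (z + k'%:Z)%:~R; last by exists m;
    apply: (intr_inj (R := R)); rewrite em intrM.
  by apply/inn; exists 1; rewrite intrD; ring.
(* The map [-r_al] sends [2 al + z a] to [2 al - z a], which lies in the same fibre. *)
have [m3 em3] : exists m, - 2 * z = k'%:Z * m.
  have : S (2 *: al i + (- z%:~R) *: a).
    have := mers_opp M (mers_refl M Sa Sy); rewrite reflE ey' (cart_ar M) cartZr.
    by rewrite (cart_alal M B); congr S; vring.
  case/inn=> m em; exists m; apply: (intr_inj (R := R)).
  by rewrite !intrM -em; ring.
(* A shift by [k] in the fibre of [al] acts on the fibre of [al'] as a shift by [4k], because [al]
   pairs with [al'] to 4. *)
have [m4 em4] : exists m, 4 * k%:Z = k'%:Z * m.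
  have Sak : S (al i + k%:R *: a) by apply/(fibP M B) => //; exists 1; rewrite mulr1.
  have := mers_shift M Sa Sak Sy; rewrite {2}ey' (cart_ar M) cartZr (cart_alal M B).
  case/(fibP M B _ Sy)=> m em; exists m; apply: (intr_inj (R := R)).
  by rewrite !intrM -em; ring.
have kn0 : (0 < k)%N by rewrite -(ltr0n R).
have kn'0 : (0 < k')%N by rewrite -(ltr0n R).
pose d := m2 - m1; pose m := - m1.
have ek' : k'%:Z = k%:Z * d by rewrite /d mulrBr -em1 -em2; lia.
have d0 : 0 < d by nia.
have m0 : 0 <= m by rewrite /m; nia.
have md : m < d by rewrite /m /d; nia.
have dm : 2 * m = d * m3.
  have : k%:Z * (2 * m) = k%:Z * (d * m3) by rewrite mulrA -ek' -em3 em1 /m; ring.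
  by nia.
have d4 : 4 = d * m4.
  have : k%:Z * 4 = k%:Z * (d * m4) by rewrite mulrA -ek' -em4 mulrC.
  by nia.
have {dm} cases : (d = 1 /\ m = 0) \/ (d = 2 /\ m = 0) \/ (d = 2 /\ m = 1) \/
    (d = 4 /\ m = 0) \/ (d = 4 /\ m = 2).
  have : (`|d| %| 4)%N by apply/dvdnP; exists `|m4|%N; nia.
  rewrite dvdn_divisors // inE /= !inE => h.
  have : d = 1 \/ d = 2 \/ d = 4 by lia.
  by case=> [|[|]] ed; rewrite ed in dm md *; lia.
have ezR : z%:~R = - (k%:R * m%:~R) :> R by rewrite em1 intrM /m intrN; ring.
have ek'R : k'%:R = k%:R * d%:~R :> R by rewrite -[k%:R]/(k%:~R) -intrM -ek'.
clear em4 d4 ek'; clearbody d m.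
have eq : q i = k%:R * (d - m)%:~R / 2.
  apply: (@knrE i 2); rewrite ?pnatr_eq0 // starE -/y -/k' ek'R ey' ezR intrB.
  by vfield.
have es : star S a y = 2 *: (al i + q i *: a).
  by rewrite starE -/k' eq ek'R ey' ezR intrB; vfield.
have kne : k%:R != 0 :> R by rewrite gt_eqF.
have S2 : S (2 *: al i) <-> exists m' : int, m = d * m'.
  rewrite -[2 *: al i]addr0 -(scale0r a) inn ezR ek'R; split=> -[m' e]; exists m'.
    apply: (intr_inj (R := R)); apply: (mulfI kne).
    by rewrite intrM mulrA -e; ring.
  by rewrite -mulrA -intrM -e; ring.
have i0 : 0%:~R = 0 :> R by [].
have i1 : 1%:~R = 1 :> R by [].
have i2 : 2%:~R = 2 :> R by [].
have i4 : 4%:~R = 4 :> R by [].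
have excl : ~ (d = 4 /\ m = 0).
  case=> ed em; have ns2 : ~ S (2 *: al i).
    case: HP => _ _ pc _; apply: pc.
    (* Here the fibre over [2 al] would be [4 k Z], so the double of [al + k a], at offset [2k], is
       not a root. *)
    have Sak : S (al i + k%:R *: a) by apply/(fibP M B) => //; exists 1; rewrite mulr1.
    exists (al i + k%:R *: a); split=> //; first by apply/(proj_eq HM Ha); exists k%:R.
    rewrite scalerDr scalerA inn ezR ek'R ed em => -[x].
    rewrite i0 mulr0 oppr0 subr0 -mulrA [2 * _]mulrC => /(mulfI kne).
    rewrite -i2 -intrM => /intr_inj; lia.
  by case: ns2; apply/S2; exists 0; rewrite em mulr0.
rewrite es; split=> //.
- by rewrite eq divr_gt0 // mulr_gt0 // ltr0z subr_gt0.
- rewrite eq; case: cases excl => [|[|[|[|]]]] [-> ->] excl; rewrite intrB;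
  rewrite ?(i0, i1, i2, i4); first [by left; field | by right; field | by case: excl].
case: cases => [|[|[|[|]]]] [/[dup]ed ed' /[dup]em em'];
  rewrite ed em in S2 ezR ek'R eq;
  rewrite eq ?(intrB, i0, i1, i2, i4).
- left; split; first by apply/S2; exists 0.
  by move=> t; rewrite inn ezR ek'R ?(i0, i1, i2, i4); split=> -[v e]; exists v; lra.
- left; split; first by apply/S2; exists 0.
  by move=> t; rewrite inn ezR ek'R ?(i0, i1, i2, i4); split=> -[v e]; exists v; lra.
- right; split; first by move/S2 => [v]; lia.
  move=> t; rewrite inn ezR ek'R ?(i0, i1, i2, i4); split=> -[v e].
    by exists (v - 1); rewrite intrB i1; lra.
  by exists (v + 1); rewrite intrD i1; lra.
- by case: excl; rewrite ed' em'.
- right; split; first by move/S2 => [v]; lia.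
  move=> t; rewrite inn ezR ek'R ?(i0, i1, i2, i4); split=> -[v e].
    by exists (v - 1); rewrite intrB i1; lra.
  by exists (v + 1); rewrite intrD i1; lra.
Qed.

Lemma q_gt0 i : 0 < q i.
Proof.
have [nw|/white_data[-> _ _]] := pselect (nonwhite i).
  by case: (nonwhite_data nw).
exact: (kk_gt0 M B (base_S B i)).
Qed.

(* al + q a is proportional to a root. *)
Lemma q_refl i y : S y -> S (reflection I (al i + q i *: a) y).
Proof.
have [nw|/white_data[eq _ _]] := pselect (nonwhite i); last first.
  apply: (reflection_stable M (oner_neq0 _)); rewrite scale1r eq.
  by apply/(fibP M B); [exact: (base_S B)|exists 1; rewrite mulr1].
have [_ e _ _] := nonwhite_data nw; have n2 : 2 != 0 :> R by rewrite pnatr_eq0.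
apply: (reflection_stable M n2); rewrite -e starE.
have [Sy _ _ _] := nonwhite_prime nw.
by apply/(fibP M B) => //; exists 1; rewrite mulr1.
Qed.

Lemma q_shift i y : S y -> S (y + (q i * cart (al i) y) *: a).
Proof.
move=> Sy; rewrite -(refl_shift M) ?(mers_nz M) //; last exact: (base_S B).
by apply/q_refl/(mers_refl M) => //; exact: (base_S B).
Qed.

(** The reflections in [al_i] and in [al_i + q_i a] compose to a shift by [q_i C_ij] in the fibre of
    [al_j]. If the counting number of [al_i] is [2 q_i], this is stronger than what the fibre of
    [al_i] provides. *)
Lemma kk_dvd i j : exists m : int, q i * C i j = (kk (al j))%:R * m%:~R.
Proof. by have := q_shift i (base_S B j) => /(fibP M B _ (base_S B j)). Qed.

Lemma kk_q i : (kk (al i))%:R = q i \/ (kk (al i))%:R = 2 * q i.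
Proof.
have [nw|/white_data[-> _ _]] := pselect (nonwhite i); last by left.
by case: (nonwhite_data nw).
Qed.

Definition coef i : R := (null_coef I S G P.1 i)%:R.

Lemma coef_gt0 i : 0 < coef i.
Proof. by rewrite ltr0n; case: (null_coef_gen HM Ha HP). Qed.

Lemma coef_null : null_comb I al coef.
Proof. by case: (null_coef_gen HM Ha HP). Qed.

(** Up to a factor 2, the coefficients of the null vector written in the coroots instead of the
    roots. *)
Definition coef_form i := coef i * I (al i) (al i).
Local Notation u := coef_form.

Lemma u_gt0 i : 0 < u i.
Proof. by rewrite mulr_gt0 ?coef_gt0 // (base_gt0 M B). Qed.

Lemma exponentE i : exponent I S G a P.1 i = form_scale I S / 2 * (u i / q i).
Proof.
rewrite /exponent -/(coef i) -/(q i) /coef_form; field.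
by rewrite gt_eqF ?q_gt0.
Qed.

Lemma form_scale_gt0 : 0 < form_scale I S.
Proof. by case: (form_scaleP M B). Qed.

Lemma exponent_le i j :
  (exponent I S G a P.1 i <= exponent I S G a P.1 j) = (u i / q i <= u j / q j).
Proof. by rewrite !exponentE ler_pM2l // divr_gt0 // form_scale_gt0. Qed.

(** The null relation with its diagonal term isolated. All terms on the right are nonnegative, so
    any selection of neighbours is bounded by [2 u_i]. *)
Lemma u_sum i : 2 * u i = \sum_(j | j != i) u j * - C j i.
Proof.
have e j : u j * - C j i = - 2 * (coef j * I (al j) (al i)).
  transitivity (- (coef j * (C j i * I (al j) (al j))));
    first by rewrite /coef_form; ring.
  by rewrite (cart_form M _ (base_S B j)); ring.
under eq_bigr do rewrite e.
rewrite -big_distrr /=; have := coef_null i; rewrite (bigD1 i) //= => /eqP.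
by rewrite addr_eq0 -/(u i) => /eqP ->; ring.
Qed.

Lemma C_int i j : exists z : int, C i j = z%:~R.
Proof. by apply: (mers_int M); exact: (base_S B). Qed.

Lemma C_le0 i j : i != j -> C i j <= 0.
Proof. exact: (cart_le0 M B). Qed.

Lemma C_neq0 i j : C i j != 0 -> C j i != 0.
Proof. by rewrite !(cart_neq0 M B) formC. Qed.

Lemma C_leN1 i j : i != j -> C i j != 0 -> C i j <= -1.
Proof.
move=> ij; have := C_le0 ij; have [z ->] := C_int i j.
rewrite intr_eq0 lerz0 -[-1]/((-1)%:~R) ler_int; lia.
Qed.

Lemma u_sum_ge0 i j : j != i -> 0 <= u j * - C j i.
Proof. by move=> ji; have := u_gt0 j; have := C_le0 ji; nra. Qed.

Lemma u_neighbour i j : j != i -> u j * - C j i <= 2 * u i.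
Proof.
move=> ji; rewrite u_sum (bigD1 j) //= lerDl.
by apply: sumr_ge0 => k /andP[ki _]; apply: u_sum_ge0.
Qed.

Lemma u_neighbour2 i j k : j != i -> k != i -> j != k ->
  u j * - C j i + u k * - C k i <= 2 * u i.
Proof.
move=> ji ki jk; rewrite u_sum (bigD1 j) //= (bigD1 k) /=; last by rewrite ki eq_sym.
rewrite addrA lerDl.
by apply: sumr_ge0 => h /andP[/andP[hi _] _]; apply: u_sum_ge0.
Qed.

Lemma kk_le i j : i != j -> C i j != 0 -> (kk (al j))%:R <= q i * - C i j.
Proof.
move=> ij nz; have [m em] := kk_dvd i j; have q0 := q_gt0 i.
have k0 := kk_gt0 M B (base_S B j); have := C_leN1 ij nz => c1.
have : (kk (al j))%:R * m%:~R < 0 :> R by rewrite -em; nra.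
rewrite pmulr_rlt0 // ltrz0 => m0; rewrite mulrN em.
have : m%:~R <= -1 :> R by rewrite -[-1]/((-1)%:~R) ler_int; lia.
nra.
Qed.

Lemma q_le_kk j : q j <= (kk (al j))%:R.
Proof. by have := q_gt0 j; case: (kk_q j) => ->; lra. Qed.

(** Half of [C i j] is the pairing of the root [2 al_i + t a] with [al_j], hence an integer. *)
Lemma C_even i j : nonwhite i -> j != i -> C i j != 0 -> C i j <= -2.
Proof.
move=> [t St] ji nz; have [z ez] := mers_int M St (base_S B j).
move: ez; rewrite (cart_a M) cart_scalel ?pnatr_eq0 // => ez.
have {ez} ez : C i j = 2 * z%:~R by rewrite -ez; field.
have ij : i != j by rewrite eq_sym.
move: nz (C_le0 ij); rewrite ez => nz.
rewrite mulf_eq0 pnatr_eq0 intr_eq0 /= in nz.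
rewrite pmulr_rle0 // lerz0 => z0.
have : z%:~R <= -1 :> R by rewrite -[-1]/((-1)%:~R) ler_int; lia.
lra.
Qed.

(** Walks from [i] that never turn straight back, with the last edge recorded. Vertices may be
    revisited; all that matters is that [p] and [k] are two different neighbours of [j], to which
    [u_neighbour2] applies. *)
Inductive chain (i : 'I_n) : 'I_n -> 'I_n -> Prop :=
| Chain0 j : j != i -> C i j != 0 -> chain i i j
| ChainS p j k : chain i p j -> k != j -> k != p -> C j k != 0 -> chain i j k.

Lemma chain_conn i j : j = i \/ exists p, chain i p j.
Proof.
move: j; apply: (base_conn M B) => [|j k]; first by exists i; left.
move=> h nz; have {}nz : C j k != 0 by rewrite (cart_neq0 M B).
have [->|kj] := eqVneq k j; first exact: h.
case: h => [ej|[p cp]].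
  by right; exists i; move: nz kj; rewrite ej => nz kj; constructor.
have [ekp|kp] := eqVneq k p; last by right; exists j; apply: ChainS cp _ _ _.
case: cp ekp => [j' _ _|p' j' k' cp' _ _ _] ->; first by left.
by right; exists p'.
Qed.

(* Along a chain issuing from i the function u decreases by concavity: at j the
   term of the predecessor p already accounts for half of the sum 2 u j. *)
Lemma chain_bound i p j : nonwhite i ->
  (forall j, j != i -> C i j != 0 -> 2 * q i <= q j * - C j i) ->
  chain i p j -> [/\ j != p, u j <= u p * - C p j & u j / q j <= u i / q i].
Proof.
move=> nw am; elim=> {p j} [j ji nz|p j k _ [jp h1 h2] kj kp nz].
  have nz' := C_neq0 nz; have un := u_neighbour ji.
  (* The evenness at [i] compensates the factor 2 in [u_j (- C_ji) <= 2 u_i]; in the bound on the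
     ratios the hypothesis on [q] does so. *)
  have c2 := C_even nw ji nz; have c1 := C_leN1 ji nz'.
  have uj := u_gt0 j; have ui := u_gt0 i; have qi := q_gt0 i; have qj := q_gt0 j.
  split=> //; first by nra.
  rewrite ler_pdivrMr // mulrAC ler_pdivlMr //.
  have := am _ ji nz; nra.
have nz' := C_neq0 nz.
have un := u_neighbour2 (_ : p != j) kj (_ : p != k).
have {}un : u p * - C p j + u k * - C k j <= 2 * u j by apply: un; rewrite eq_sym.
have c1 := C_leN1 kj nz'; have jk : j != k by rewrite eq_sym.
have c1' := C_leN1 jk nz.
have uj := u_gt0 j; have uk := u_gt0 k; have qk := q_gt0 k; have qj := q_gt0 j.
have ukj : u k * - C k j <= u j by lra.
split=> //; first by nra.
apply: le_trans h2; rewrite ler_pdivrMr // mulrAC ler_pdivlMr //.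
have := kk_le kj nz'; have := q_le_kk j => h3 h4.
have : u k * q j <= u k * (q k * - C k j) by rewrite ler_pM2l //; lra.
have : u k * - C k j * q k <= u j * q k by rewrite ler_pM2r.
lra.
Qed.

Lemma double_max i : nonwhite i -> (kk (al i))%:R = 2 * q i ->
  max_exponent I S G a P.1 i.
Proof.
move=> nw ki; apply/forallP => j; rewrite exponent_le.
have [->|[p cp]] := chain_conn i j; first exact: lexx.
have [] // := chain_bound nw _ cp.
(* The factor 2 in the hypothesis of [chain_bound] is exactly the gain of [2 q_i] over [q_i] as
   counting number. *)
move=> k ki' nz; rewrite -ki; apply: kk_le => //; exact: C_neq0.
Qed.

End Exponents.

(** * Diagrams *)

Section Colours.
Variables (R : realType) (F : vectType R) (I : {symmetric F}).
Variables (S : set F) (G : {vspace F}) (a : F).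
Hypothesis HM : marked_elliptic I S G.
Hypothesis Ha : generator (subgroup_gen S `&` [set x | x \in G]) a.
Variables (n : nat) (P : n.-tuple F * n.-tuple F).
Hypothesis HP : paired_simple_system S G a P.
Local Notation proj := (quot_proj G).
Local Notation cart := (cart I).
Local Notation al := (tnth P.1).
Local Notation kk := (counting_number S a).
Local Notation q := (knr_at S G a P).
Local Notation nonwhite := (nonwhite S a P).
Let M : mers I S a := marked_mers HM Ha.
Let B : base S a al := paired_base HM Ha HP.

Definition mult i : R := if `[< nonwhite i >] then 2 else 1.

Lemma mult_gt0 i : 0 < mult i.
Proof. by rewrite /mult; case: asbool. Qed.

Lemma star_tnth i : star S a (tnth P.2 i) = mult i *: (al i + q i *: a).
Proof.
case: (HP) => _ _ _ ->; rewrite tnth_map /mult; case: asboolP => nw.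
  by case: (nonwhite_data HM Ha HP nw).
by rewrite scale1r; case: (white_data HM Ha HP nw).
Qed.

Lemma half_al i t : ~ S (2^-1 *: al i + t *: a).
Proof.
move=> h; have [c [u [e _]]] := base_sign B h.
have e' : 2^-1 *: al i + t *: a = comb a al (fun j => 2^-1 *+ (j == i)) t.
  rewrite (@combZ _ _ a _ al i) ?eqxx //.
  by move=> j /negPf ->.
move: e; rewrite e' => /(comb_inj B)[/(_ i) + _]; rewrite eqxx mulr1n => ci.
have : (2 * c i)%:~R = 1%:~R :> R by rewrite intrM -ci mulfV // pnatr_eq0.
move/intr_inj; lia.
Qed.

Lemma quadruple_al i t : ~ S (4 *: al i + t *: a).
Proof.
move=> h; have [z] := mers_int M h (base_S B i).
rewrite (cart_a M) cart_scalel ?pnatr_eq0 // (cart_alal M B) => e.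
have : (2 * z)%:~R = 1%:~R :> R by rewrite intrM -e; field.
move/intr_inj; lia.
Qed.

Lemma half_quot i : ~ root_quot S G (2^-1 *: proj (al i)).
Proof. by move/(root_quotP HM Ha) => [t] /half_al. Qed.

Lemma colour_dc i : colour_of S G (al i) =
  if `[< S (2 *: al i) >] then Black else
  if `[< nonwhite i >] then Gray else White.
Proof.
have nh : ~ S (2^-1 *: al i).
  by rewrite -[_ *: al i]addr0 -(scale0r a) => /half_al.
rewrite /colour_of; case: asboolP => [[h|//]|/not_orP[h _]].
  by rewrite asboolT.
rewrite [in RHS]asboolF //; case: asboolP => [[/(root_quotP HM Ha) h'|/half_quot//]|].
  by rewrite asboolT.
by move/not_orP=> [h' _]; rewrite asboolF // => h''; apply/h'/(root_quotP HM Ha).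
Qed.

Lemma al_q i : nonwhite i ->
  S (al i + q i *: a) <-> (kk (al i))%:R = q i.
Proof.
move=> nw; have q0 := q_gt0 HM Ha HP i.
rewrite (fibP M B) //; last exact: (base_S B).
have [_ _ + _] := nonwhite_data HM Ha HP nw => -[]-> .
  by split=> // _; exists 1; rewrite mulr1.
split=> [[m e]|e]; last by lra.
have : (2 * m)%:~R = 1%:~R :> R.
  by apply: (mulfI (lt0r_neq0 q0)); rewrite intrM mulr1 [RHS]e; ring.
move/intr_inj; lia.
Qed.

(** For nonwhite [al_i] the star node is [2 (al_i + q_i a)]. Its double cannot be a root by
    integrality, so it is black exactly when its half is a root, that is, when the counting number
    is [q_i] and not [2 q_i]. *)
Lemma colour_star i : colour_of S G (star S a (tnth P.2 i)) =
  if `[< nonwhite i >] then if `[< (kk (al i))%:R = q i >] then Black else Gray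
  else White.
Proof.
rewrite star_tnth /mult; case: asboolP => nw; last first.
  rewrite scale1r /colour_of asboolF; last first.
    case; rewrite scalerDr scalerA; last exact: half_al.
    by move=> h; apply: nw; exists (2 * q i).
  have e : proj (al i + q i *: a) = proj (al i) by apply/(proj_eq HM Ha); exists (q i).
  by rewrite e asboolF // => -[/(root_quotP HM Ha)|/half_quot].
have n2 : 2 != 0 :> R by rewrite pnatr_eq0.
have e2 : 2^-1 *: (2 *: (al i + q i *: a)) = al i + q i *: a.
  by rewrite scalerA mulVf // scale1r.
have n4 : ~ S (2 *: (2 *: (al i + q i *: a))).
  by rewrite !scalerDr !scalerA -natrM => /quadruple_al.
rewrite /colour_of e2; case: asboolP => [[//|h]|/not_orP[_ h]].
  by rewrite asboolT //; apply/al_q.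
rewrite asboolT; last first.
  right; apply/(root_quotP HM Ha); rewrite e2; exists (- q i).
  by rewrite -addrA -scalerDl subrr scale0r addr0; exact: (base_S B).
by rewrite asboolF // => /(al_q nw).
Qed.

End Colours.

(** * From equal data to isomorphic systems and isomorphic diagrams *)

Section BaseExtension.
Variables (R : realType) (F1 F2 : vectType R) (S1 : set F1) (a1 : F1) (a2 : F2).
Variables (n : nat) (al : 'I_n -> F1) (be : 'I_n -> F2).
Hypothesis B : base S1 a1 al.

Lemma base_tuple_free : free [tuple of a1 :: mktuple al].
Proof.
set X := [tuple of _].
have Xi (i : 'I_n) : X`_(lift ord0 i) = al i.
  by rewrite -[RHS](tnth_mktuple al) (tnth_nth 0) lift0.
apply/freeP => k; rewrite big_ord_recl.
under eq_bigr do rewrite Xi.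
rewrite addrC => /(base_free B)[h h0] i.
by case: (unliftP ord0 i) => [j|] ->.
Qed.

Lemma base_extension : exists f : 'Hom(F1, F2),
  (forall i, f (al i) = be i) /\ f a1 = a2.
Proof.
pose X := [tuple of a1 :: mktuple al]; pose Y := a2 :: mktuple be.
have [f Hf] := linear_of_free X Y.
have fX : free X := base_tuple_free.
have sz : size Y = size X by rewrite /= !size_tuple.
have [e0 e'] := Hf fX sz; have e : map f (mktuple al) = mktuple be := e'.
exists (linfun f); split=> [i|]; last by rewrite lfunE.
rewrite lfunE /= -[RHS](tnth_mktuple be) (tnth_nth 0) -e (nth_map 0) ?size_tuple //.
by rewrite -tnth_nth tnth_mktuple.
Qed.

Lemma hom_comb (f : 'Hom(F1, F2)) : (forall i, f (al i) = be i) -> f a1 = a2 ->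
  forall c t, f (comb a1 al c t) = comb a2 be c t.
Proof.
move=> fi fa c t; rewrite /comb linearD linearZ /= fa; congr (_ + _).
by rewrite linear_sum; apply: eq_bigr => i _; rewrite linearZ /= fi.
Qed.

End BaseExtension.

(** The middle term of the equivalence: [mers_iso] and [diagram_iso] are each shown to produce, and
    to follow from, such a matching of simple roots. *)
Definition data_iso (R : realType) (F1 F2 : vectType R)
    (I1 : {symmetric F1}) (I2 : {symmetric F2}) (S1 : set F1) (S2 : set F2)
    (G1 : {vspace F1}) (G2 : {vspace F2}) (a1 : F1) (a2 : F2) (n1 n2 : nat)
    (P1 : n1.-tuple F1 * n1.-tuple F1) (P2 : n2.-tuple F2 * n2.-tuple F2)
    (f : 'I_n1 -> 'I_n2) (g : 'I_n2 -> 'I_n1) :=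
  [/\ cancel f g /\ cancel g f,
      forall i j, cart I1 (tnth P1.1 i) (tnth P1.1 j) =
                  cart I2 (tnth P2.1 (f i)) (tnth P2.1 (f j)),
      forall i, S1 (2 *: tnth P1.1 i) <-> S2 (2 *: tnth P2.1 (f i)),
      forall i, nonwhite S1 a1 P1 i <-> nonwhite S2 a2 P2 (f i)
    & forall i, knr_at S1 G1 a1 P1 i = knr_at S2 G2 a2 P2 (f i) /\
        counting_number S1 a1 (tnth P1.1 i) = counting_number S2 a2 (tnth P2.1 (f i))].

Lemma data_iso_sym (R : realType) (F1 F2 : vectType R)
    (I1 : {symmetric F1}) (I2 : {symmetric F2}) (S1 : set F1) (S2 : set F2)
    (G1 : {vspace F1}) (G2 : {vspace F2}) (a1 : F1) (a2 : F2) (n1 n2 : nat)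
    (P1 : n1.-tuple F1 * n1.-tuple F1) (P2 : n2.-tuple F2 * n2.-tuple F2) f g :
  data_iso I1 I2 S1 S2 G1 G2 a1 a2 P1 P2 f g ->
  data_iso I2 I1 S2 S1 G2 G1 a2 a1 P2 P1 g f.
Proof.
case=> -[fK gK] hc h2 hn hq; split=> //.
- by move=> i j; rewrite hc !gK.
- by move=> i; rewrite h2 gK.
- by move=> i; rewrite hn gK.
- by move=> i; have [] := hq (g i); rewrite gK.
Qed.

Section Isomorphisms.
Variables (R : realType) (F1 F2 : vectType R).
Variables (I1 : {symmetric F1}) (I2 : {symmetric F2}).
Variables (S1 : set F1) (S2 : set F2) (G1 : {vspace F1}) (G2 : {vspace F2}).
Variables (a1 : F1) (a2 : F2).
Hypotheses (HM1 : marked_elliptic I1 S1 G1) (HM2 : marked_elliptic I2 S2 G2).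
Hypothesis Ha1 : generator (subgroup_gen S1 `&` [set x | x \in G1]) a1.
Hypothesis Ha2 : generator (subgroup_gen S2 `&` [set x | x \in G2]) a2.
Variables (n1 n2 : nat).
Variables (P1 : n1.-tuple F1 * n1.-tuple F1) (P2 : n2.-tuple F2 * n2.-tuple F2).
Hypothesis HP1 : paired_simple_system S1 G1 a1 P1.
Hypothesis HP2 : paired_simple_system S2 G2 a2 P2.
Local Notation al1 := (tnth P1.1).
Local Notation al2 := (tnth P2.1).
Local Notation q1 := (knr_at S1 G1 a1 P1).
Local Notation q2 := (knr_at S2 G2 a2 P2).
Let M1 : mers I1 S1 a1 := marked_mers HM1 Ha1.
Let M2 : mers I2 S2 a2 := marked_mers HM2 Ha2.
Let B1 : base S1 a1 al1 := paired_base HM1 Ha1 HP1.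
Let B2 : base S2 a2 al2 := paired_base HM2 Ha2 HP2.

(** Equal Cartan integers make [phi] commute with simple reflections, so [root_ind] reduces the
    claim to the fibres over [al_i] and [2 al_i]. The opposite inclusion will come from the inverse
    matching. *)
Lemma data_hom f g (phi : 'Hom(F1, F2)) :
  data_iso I1 I2 S1 S2 G1 G2 a1 a2 P1 P2 f g ->
  (forall i, phi (al1 i) = al2 (f i)) -> phi a1 = a2 ->
  forall x, S1 x -> S2 (phi x).
Proof.
case=> -[fK gK] hc h2 hn hq phi_al phi_a x Sx; pattern x.
apply: (root_ind M1 B1) Sx => [i y t Sy e|i y t Sy e|i y Sy Sphi].
- rewrite e linearD linearZ /= phi_al phi_a.
  apply/(fibP M2 B2) => //; first exact: (base_S B2).
  have [_ <-] := hq i; apply/(fibP M1 B1); first exact: (base_S B1).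
  by rewrite -e.
- rewrite e linearD !linearZ /= phi_al phi_a; rewrite e in Sy.
  have nw : nonwhite S1 a1 P1 i by exists t.
  have nw' : nonwhite S2 a2 P2 (f i) by apply/hn.
  have [eq _] := hq i.
  case: (nonwhite_data HM1 Ha1 HP1 nw) => _ _ _.
  case: (nonwhite_data HM2 Ha2 HP2 nw') => _ _ _.
  move=> [[b2 h2']|[b2 h2']] [[b1 h1']|[b1 h1']].
  + by apply/h2'; rewrite -eq; apply/h1'.
  + by case: b1; apply/h2.
  + by case: b2; apply/h2.
  + by apply/h2'; rewrite -eq; apply/h1'.
have -> : phi (reflection I1 (al1 i) y) = reflection I2 (al2 (f i)) (phi y).
  rewrite !reflE linearB linearZ /= phi_al; congr (_ - _ *: _).
  have [c [t ->]] := base_span B1 y; rewrite (hom_comb phi_al phi_a).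
  rewrite (cart_ar M1) (cart_ar M2) /cart !form_sumr !big_distrr /=.
  by apply: eq_bigr => j _; rewrite !formZr ![2 / _ * _]mulrCA -!/(cart _ _ _) hc.
by apply: (mers_refl M2) => //; exact: (base_S B2).
Qed.

End Isomorphisms.

Section DataIso.
Variables (R : realType) (F1 F2 : vectType R).
Variables (I1 : {symmetric F1}) (I2 : {symmetric F2}).
Variables (S1 : set F1) (S2 : set F2) (G1 : {vspace F1}) (G2 : {vspace F2}).
Variables (a1 : F1) (a2 : F2).
Hypotheses (HM1 : marked_elliptic I1 S1 G1) (HM2 : marked_elliptic I2 S2 G2).
Hypothesis Ha1 : generator (subgroup_gen S1 `&` [set x | x \in G1]) a1.
Hypothesis Ha2 : generator (subgroup_gen S2 `&` [set x | x \in G2]) a2.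
Variables (n1 n2 : nat).
Variables (P1 : n1.-tuple F1 * n1.-tuple F1) (P2 : n2.-tuple F2 * n2.-tuple F2).
Hypothesis HP1 : paired_simple_system S1 G1 a1 P1.
Hypothesis HP2 : paired_simple_system S2 G2 a2 P2.
Local Notation al1 := (tnth P1.1).
Local Notation al2 := (tnth P2.1).
Local Notation q1 := (knr_at S1 G1 a1 P1).
Local Notation q2 := (knr_at S2 G2 a2 P2).
Let M1 : mers I1 S1 a1 := marked_mers HM1 Ha1.
Let M2 : mers I2 S2 a2 := marked_mers HM2 Ha2.
Let B1 : base S1 a1 al1 := paired_base HM1 Ha1 HP1.
Let B2 : base S2 a2 al2 := paired_base HM2 Ha2 HP2.

Lemma data_iso_mers f g : data_iso I1 I2 S1 S2 G1 G2 a1 a2 P1 P2 f g ->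
  mers_iso S1 G1 S2 G2.
Proof.
move=> h; have h' := data_iso_sym h; have [[fK gK] _ _ _ _] := h.
have [phi [phi_al phi_a]] := base_extension a2 (fun i => al2 (f i)) B1.
have [psi [psi_al psi_a]] := base_extension a1 (fun i => al1 (g i)) B2.
have phiK : cancel phi psi.
  move=> x; have [c [t ->]] := base_span B1 x.
  rewrite (hom_comb phi_al phi_a) /comb !linearD !linearZ /= psi_a; congr (_ + _).
  by rewrite linear_sum; apply: eq_bigr => i _; rewrite linearZ /= psi_al fK.
have psiK : cancel psi phi.
  move=> x; have [c [t ->]] := base_span B2 x.
  rewrite (hom_comb psi_al psi_a) /comb !linearD !linearZ /= phi_a; congr (_ + _).
  by rewrite linear_sum; apply: eq_bigr => i _; rewrite linearZ /= phi_al gK.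
exists phi; split; first by exists psi.
- apply/seteqP; split=> [_ [x Sx <-]|y Sy].
    exact: (data_hom HM1 HM2 Ha1 Ha2 HP1 HP2 h).
  exists (psi y); last by rewrite psiK.
  exact: (data_hom HM2 HM1 Ha2 Ha1 HP2 HP1 h').
by rewrite (marked_line HM1 Ha1) (marked_line HM2 Ha2) limg_line phi_a.
Qed.

Lemma exponent_eq f g : cancel f g -> cancel g f ->
  (forall i j, cart I1 (al1 i) (al1 j) = cart I2 (al2 (f i)) (al2 (f j))) ->
  forall i, exponent I1 S1 G1 a1 P1.1 i = exponent I2 S2 G2 a2 P2.1 (f i)
    <-> q1 i = q2 (f i).
Proof.
move=> fK gK hc i.
rewrite /exponent -/(q1 i) -/(q2 (f i)) (form_scale_eq M1 M2 B1 B2 gK hc).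
have <- := null_gen_eq M1 M2 B1 B2 fK gK hc (null_coef_gen HM1 Ha1 HP1)
  (null_coef_gen HM2 Ha2 HP2) i.
split=> [|-> //].
have d0 : (null_coef I1 S1 G1 P1.1 i)%:R != 0 :> R.
  by rewrite lt0r_neq0 //; apply: (coef_gt0 HM1 Ha1 HP1).
have l0 : form_scale I2 S2 * I2 (al2 (f i)) (al2 (f i)) != 0.
  by rewrite lt0r_neq0 // mulr_gt0 ?(form_scale_gt0 HM2 Ha2 HP2) // (base_gt0 M2 B2).
move=> /(mulIf d0)/(mulfI l0)/invr_inj/mulfI; apply.
by rewrite pnatr_eq0.
Qed.

Lemma data_iso_diagram f g : data_iso I1 I2 S1 S2 G1 G2 a1 a2 P1 P2 f g ->
  diagram_iso (diagram_of I1 S1 G1 a1 P1) (diagram_of I2 S2 G2 a2 P2).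
Proof.
move=> [[fK gK] hc h2 hn hq].
have he i : exponent I1 S1 G1 a1 P1.1 i = exponent I2 S2 G2 a2 P2.1 (f i).
  by apply/(exponent_eq fK gK hc); case: (hq i).
have hm i : max_exponent I1 S1 G1 a1 P1.1 i = max_exponent I2 S2 G2 a2 P2.1 (f i).
  apply/forallP/forallP => h j; last by rewrite !he.
  by rewrite -(gK j) -!he.
have hm1 (s : star_index I1 S1 G1 a1 P1) : max_exponent I2 S2 G2 a2 P2.1 (f (val s)).
  by rewrite -hm; apply: valP.
have hm2 (s : star_index I2 S2 G2 a2 P2) : max_exponent I1 S1 G1 a1 P1.1 (g (val s)).
  by rewrite hm gK; apply: valP.
have emult i : mult S1 a1 P1 i = mult S2 a2 P2 (f i).
  by rewrite /mult (asbool_equiv_eq (hn i)).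
pose F (x : 'I_n1 + star_index I1 S1 G1 a1 P1) : 'I_n2 + star_index I2 S2 G2 a2 P2 :=
  match x with inl i => inl (f i) | inr s => inr (exist (fun i => is_true
    (max_exponent I2 S2 G2 a2 P2.1 i)) _ (hm1 s)) end.
pose F' (x : 'I_n2 + star_index I2 S2 G2 a2 P2) : 'I_n1 + star_index I1 S1 G1 a1 P1 :=
  match x with inl i => inl (g i) | inr s => inr (exist (fun i => is_true
    (max_exponent I1 S1 G1 a1 P1.1 i)) _ (hm2 s)) end.
exists F; split.
- exists F'; case=> [i|s] /=; rewrite ?fK ?gK //; congr inr; apply: val_inj => /=.
    by rewrite fK.
  by rewrite gK.
- by case.
(* Every node is [c (al_i + t a)] with the same [c] on both sides; as [a] is in the radical,
   pairings see only [c] and the Cartan integers. *)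
- have node x : exists i c t u, [/\ c != 0,
      node_root x = c *: (al1 i + t *: a1)
      & node_root (F x) = c *: (al2 (f i) + u *: a2)].
    case: x => [i|s].
      by exists i, 1, 0, 0; rewrite oner_neq0 !scale1r !scale0r !addr0.
    exists (val s), (mult S1 a1 P1 (val s)), (q1 (val s)), (q2 (f (val s))).
    rewrite lt0r_neq0 ?mult_gt0 //=; split=> //; first exact: (star_tnth HM1 Ha1 HP1).
    by rewrite emult; exact: (star_tnth HM2 Ha2 HP2).
  move=> x y; rewrite /= !coroot_cart.
  have [i [c [t [u [c0 -> ->]]]]] := node x; have [j [d [v [w [d0 -> ->]]]]] := node y.
  rewrite !cartZr !cart_scalel // (cart_a M1) (cart_a M2) (cart_ar M1) (cart_ar M2).
  by rewrite hc.
- by move=> i j [<-]; exact: he.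
case=> [i|s] /=.
  rewrite (colour_dc HM1 Ha1 HP1) (colour_dc HM2 Ha2 HP2).
  by rewrite (asbool_equiv_eq (h2 i)) (asbool_equiv_eq (hn i)).
rewrite (colour_star HM1 Ha1 HP1) (colour_star HM2 Ha2 HP2).
have [<- <-] := hq (val s).
by rewrite (asbool_equiv_eq (hn _)).
Qed.

End DataIso.

(** * Reading the data off a diagram *)

Section DiagramData.
Variables (R : realType) (F1 F2 : vectType R).
Variables (I1 : {symmetric F1}) (I2 : {symmetric F2}).
Variables (S1 : set F1) (S2 : set F2) (G1 : {vspace F1}) (G2 : {vspace F2}).
Variables (a1 : F1) (a2 : F2).
Hypotheses (HM1 : marked_elliptic I1 S1 G1) (HM2 : marked_elliptic I2 S2 G2).
Hypothesis Ha1 : generator (subgroup_gen S1 `&` [set x | x \in G1]) a1.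
Hypothesis Ha2 : generator (subgroup_gen S2 `&` [set x | x \in G2]) a2.
Variables (n1 n2 : nat).
Variables (P1 : n1.-tuple F1 * n1.-tuple F1) (P2 : n2.-tuple F2 * n2.-tuple F2).
Hypothesis HP1 : paired_simple_system S1 G1 a1 P1.
Hypothesis HP2 : paired_simple_system S2 G2 a2 P2.
Local Notation al1 := (tnth P1.1).
Local Notation al2 := (tnth P2.1).
Local Notation q1 := (knr_at S1 G1 a1 P1).
Local Notation q2 := (knr_at S2 G2 a2 P2).
Let M1 : mers I1 S1 a1 := marked_mers HM1 Ha1.
Let M2 : mers I2 S2 a2 := marked_mers HM2 Ha2.
Let B1 : base S1 a1 al1 := paired_base HM1 Ha1 HP1.
Let B2 : base S2 a2 al2 := paired_base HM2 Ha2 HP2.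

(** For [i != j] the vector [c al_i - d al_j] would be null, while a nonzero null combination has
    coefficients of one strict sign. This recovers the simple root over which a star node lies, a
    correspondence that a diagram isomorphism is not assumed to respect. *)
Lemma proportional_columns i j (c d : R) : 0 < c -> 0 < d ->
  (forall k, c * cart I1 (al1 k) (al1 i) = d * cart I1 (al1 k) (al1 j)) -> i = j.
Proof.
move=> c0 d0 h; apply/eqP/contraT => ij.
pose x k : R := c *+ (k == i) - d *+ (k == j).
have nx : null_comb I1 al1 x.
  move=> k; rewrite -(form_comb M1 _ _ 0).
  have -> : comb a1 al1 x 0 = c *: al1 i - d *: al1 j.
    rewrite /comb scale0r addr0; under eq_bigr do rewrite scalerBl.
    rewrite sumrB (bigD1 i) //= eqxx big1 ?addr0 => [|l /negPf -> //];
      last by rewrite scale0r.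
    rewrite (bigD1 j) //= eqxx big1 ?addr0 // => l /negPf ->; by rewrite scale0r.
  rewrite !formE (formC I1 _ (al1 k)) (formC I1 (al1 j)).
  have := h k; have := cart_form M1 (al1 i) (base_S B1 k).
  have := cart_form M1 (al1 j) (base_S B1 k).
  have := base_gt0 M1 B1 k; nra.
have [e e0 ne] := null_vec M1 B1; have [t ht] := null_unique M1 B1 e0 ne nx.
have := ht i; have := ht j; rewrite /x !eqxx eq_sym (negPf ij) mulr0n.
rewrite subr0 sub0r !mulr1n.
have := e0 i; have := e0 j; nra.
Qed.

Lemma diagram_data : diagram_iso (diagram_of I1 S1 G1 a1 P1) (diagram_of I2 S2 G2
  a2 P2) ->
  exists f g, data_iso I1 I2 S1 S2 G1 G2 a1 a2 P1 P2 f g.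
Proof.
case=> phi [[psi phiK psiK] hs hp he hcol].
have phi_inl i : exists j, phi (inl i) = inl j.
  by have := hs (inl i); case: (phi (inl i)) => // j _; exists j.
have phi_inr s : exists s', phi (inr s) = inr s'.
  by have := hs (inr s); case: (phi (inr s)) => // s' _; exists s'.
have psi_inl j : exists i, psi (inl j) = inl i.
  case e : (psi (inl j)) => [i|s]; first by exists i.
  by have [s'] := phi_inr s; rewrite -e psiK.
have psi_inr s : exists s', psi (inr s) = inr s'.
  case e : (psi (inr s)) => [i|s']; last by exists s'.
  by have [j] := phi_inl i; rewrite -e psiK.
have [f hf] : {f : 'I_n1 -> 'I_n2 & forall i, phi (inl i) = inl (f i)}.
  exact: (choice phi_inl).
have [g hg] : {g : 'I_n2 -> 'I_n1 & forall j, psi (inl j) = inl (g j)}.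
  exact: (choice psi_inl).
have fK : cancel f g.
  by move=> i; have := phiK (inl i); rewrite hf hg => -[].
have gK : cancel g f.
  by move=> i; have := psiK (inl i); rewrite hg hf => -[].
have hc i j : cart I1 (al1 i) (al1 j) = cart I2 (al2 (f i)) (al2 (f j)).
  by have := hp (inl j) (inl i); rewrite !hf /= !coroot_cart.
have hq i : q1 i = q2 (f i).
  by apply/(exponent_eq HM1 HM2 Ha1 Ha2 HP1 HP2 fK gK hc); apply: he.
have hcd i : colour_of S2 G2 (al2 (f i)) = colour_of S1 G1 (al1 i).
  by have := hcol (inl i); rewrite hf.
have hn i : nonwhite S1 a1 P1 i <-> nonwhite S2 a2 P2 (f i).
  have := hcd i; rewrite (colour_dc HM1 Ha1 HP1) (colour_dc HM2 Ha2 HP2).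
  have dbl (F : vectType R) (S : set F) a x : S (2 *: x) -> exists t, S (2 *: x + t
    *: a).
    by exists 0; rewrite scale0r addr0.
  case: (asboolP (S2 _)) => [/(dbl _ _ a2) b2|_];
    case: (asboolP (S1 _)) => [/(dbl _ _ a1) b1|_] //;
    by case: (asboolP (nonwhite S2 a2 P2 (f i))) => w2;
      case: (asboolP (nonwhite S1 a1 P1 i)) => w1.
have h2 i : S1 (2 *: al1 i) <-> S2 (2 *: al2 (f i)).
  have := hcd i; rewrite (colour_dc HM1 Ha1 HP1) (colour_dc HM2 Ha2 HP2).
  by case: (asboolP (S2 _)) => b2; case: (asboolP (S1 _)) => b1 //;
    case: asboolP.
have star_match s1 s2 : phi (inr s1) = inr s2 -> val s2 = f (val s1).
  move=> e; rewrite -[val s2]gK; congr f; symmetry.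
  apply: (proportional_columns (mult_gt0 S1 a1 P1 (val s1)) (mult_gt0 S2 a2 P2 (val
    s2))) => k.
  have := hp (inr s1) (inl k); rewrite e hf /= !coroot_cart.
  rewrite (star_tnth HM1 Ha1 HP1) (star_tnth HM2 Ha2 HP2) !cartZr.
  by rewrite (cart_ar M1) (cart_ar M2) => ->; rewrite [in RHS]hc gK.
have star_col s1 s2 : phi (inr s1) = inr s2 -> nonwhite S1 a1 P1 (val s1) ->
    (counting_number S1 a1 (al1 (val s1)))%:R = q1 (val s1) <->
    (counting_number S2 a2 (al2 (f (val s1))))%:R = q1 (val s1).
  move=> e nw; have := hcol (inr s1); rewrite e /= (colour_star HM1 Ha1 HP1).
  rewrite (colour_star HM2 Ha2 HP2) (star_match _ _ e) (asboolT nw).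
  have /asboolT -> : nonwhite S2 a2 P2 (f (val s1)) by apply/hn.
  by rewrite -hq; case: asboolP => k2; case: asboolP.
exists f, g; split=> // i; split=> //; apply/eqP; rewrite -(eqr_nat R).
have q0 := q_gt0 HM1 Ha1 HP1 i.
have [nw|nw] := pselect (nonwhite S1 a1 P1 i); last first.
  have nw' : ~ nonwhite S2 a2 P2 (f i) by rewrite -hn.
  by have [<- _ _] := white_data HM1 Ha1 HP1 nw;
    have [<- _ _] := white_data HM2 Ha2 HP2 nw'; apply/eqP.
have nw' : nonwhite S2 a2 P2 (f i) by rewrite -hn.
(* If either counting number is [2 q], then [double_max] provides a star node on that side and its
   colour decides; otherwise both equal [q]. [m1] and [m2] treat the two sides. *)
have m1 : (counting_number S1 a1 (al1 i))%:R = 2 * q1 i ->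
    (counting_number S1 a1 (al1 i))%:R = q1 i <->
    (counting_number S2 a2 (al2 (f i)))%:R = q1 i.
  move=> /(double_max HM1 Ha1 HP1 nw) mx.
  pose s1 : star_index I1 S1 G1 a1 P1 := exist (fun i => is_true (max_exponent I1
    S1 G1 a1 P1.1 i)) i mx.
  by have [s2 e] := phi_inr s1; apply: (star_col s1 s2 e).
have m2 : (counting_number S2 a2 (al2 (f i)))%:R = 2 * q2 (f i) ->
    (counting_number S1 a1 (al1 i))%:R = q1 i <->
    (counting_number S2 a2 (al2 (f i)))%:R = q1 i.
  move=> /(double_max HM2 Ha2 HP2 nw') mx.
  pose s2 : star_index I2 S2 G2 a2 P2 := exist (fun i => is_true (max_exponent I2
    S2 G2 a2 P2.1 i)) (f i) mx.
  have [s1 e'] := psi_inr s2; have e : phi (inr s1) = inr s2 by rewrite -e' psiK.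
  have es : val s1 = i by apply: (can_inj fK); rewrite -(star_match _ _ e).
  by have := star_col s1 s2 e; rewrite es => /(_ nw).
have k1 := kk_q HM1 Ha1 HP1 i; have k2 := kk_q HM2 Ha2 HP2 (f i).
rewrite -hq in k2 m2; apply/eqP.
case: k1 k2 => [e1|e1] [e2|e2]; rewrite e1 e2 //.
  by have [/(_ e1)] := m2 e2; rewrite e2.
by have [_ /(_ e2)] := m1 e1; rewrite e1.
Qed.

End DiagramData.

(** * Conjugacy of simple systems *)

Section StringsAndImages.
Variables (R : realType).

(** The left side is the pairing of [x] with [z = y + k x]. By Cauchy-Schwarz [cart x z] and
    [cart z x] have product between 0 and 4; they are integers that vanish together, so neither
    exceeds 4 in absolute value. *)
Lemma string_bound (F : vectType R) (I : {symmetric F}) (S : set F) a x y (k : int) :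
  mers I S a -> S x -> S y -> S (y + k%:~R *: x) ->
  `|cart I x y + 2 * k%:~R| <= 4.
Proof.
move=> M Sx Sy Sz; set z := y + _ in Sz.
have x0 := mers_gt0 M Sx; have z0 := mers_gt0 M Sz.
have cz : cart I x z = cart I x y + 2 * k%:~R.
  by rewrite /z cartDr cartZr cartxx ?gt_eqF // mulrC.
rewrite -cz; clearbody z; have [m em] := mers_int M Sz Sx.
have cs : I x z * I x z <= I x x * I z z.
  have := mers_pos M (I x x *: z - I x z *: x); rewrite !formE (formC I z x).
  nra.
have e1 := cart_form M z Sx; have e2 := cart_form M x Sz.
rewrite (formC I z x) in e2.
have prod : cart I x z * cart I z x <= 4.
  have p0 : 0 < I x x * I z z by apply: mulr_gt0.
  rewrite -(ler_pM2r p0).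
  have -> : cart I x z * cart I z x * (I x x * I z z) = 4 * (I x z * I x z).
    transitivity ((cart I x z * I x x) * (cart I z x * I z z)); first by ring.
    by rewrite e1 e2; ring.
  by rewrite ler_pM2l.
have prod0 : 0 <= cart I x z * cart I z x.
  have p0 : 0 < I x x * I z z by apply: mulr_gt0.
  rewrite -(ler_pM2r p0) mul0r.
  have -> : cart I x z * cart I z x * (I x x * I z z) = 4 * (I x z) ^+ 2.
    transitivity ((cart I x z * I x x) * (cart I z x * I z z)); first by ring.
    by rewrite e1 e2; ring.
  by rewrite mulr_ge0 // sqr_ge0.
have [m0|m0] := eqVneq m 0.
  move: e2; rewrite em m0 mul0r => e2.
  have -> : cart I x z = 0.
    have xz0 : I x z = 0 by lra.
    by rewrite /cart xz0 mulr0.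
  by rewrite normr0.
have m1 : 1 <= `|m%:~R| :> R by rewrite -intr_norm ler1z; lia.
rewrite em in prod prod0.
apply: le_trans (_ : `|cart I x z| * `|m%:~R| <= _).
  by rewrite ler_peMr.
by rewrite -normrM ger0_norm.
Qed.

Lemma string_sym (F : vectType R) (I : {symmetric F}) (S : set F) a x y (k c : int) :
  mers I S a -> S x -> cart I x y = c%:~R -> S (y + k%:~R *: x) ->
  S (y + (- c - k)%:~R *: x).
Proof.
move=> M Sx ec Sz; have := mers_refl M Sx Sz.
rewrite reflE cartDr cartZr cartxx ?(mers_nz M) // ec intrB intrN.
by congr S; vring.
Qed.

Variables (F1 F2 : vectType R) (I1 : {symmetric F1}) (I2 : {symmetric F2}).
Variables (S1 : set F1) (S2 : set F2) (a1 : F1) (a2 : F2).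
Hypotheses (M1 : mers I1 S1 a1) (M2 : mers I2 S2 a2).
Variables (T : {linear F1 -> F2}).
Hypothesis TS : forall x, S1 x <-> S2 (T x).

(* Reflecting the string of multiples of x through y by the two forms differs
   by a translation, which is trivial because strings are bounded. *)
Lemma cart_hom x y : S1 x -> S1 y -> cart I1 x y = cart I2 (T x) (T y).
Proof.
move=> Sx Sy.
have Sx2 : S2 (T x) by apply/TS.
have Sy2 : S2 (T y) by apply/TS.
have [c1 e1] := mers_int M1 Sx Sy; have [c2 e2] := mers_int M2 Sx2 Sy2.
have TSk (k : int) : S1 (y + k%:~R *: x) <-> S2 (T y + k%:~R *: T x).
  by rewrite TS linearD linearZ.
have step (k : int) : S1 (y + k%:~R *: x) -> S1 (y + (k + (c2 - c1))%:~R *: x).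
  move=> /TSk /(string_sym M2 Sx2 e2) /TSk /(string_sym M1 Sx e1).
  by have -> : - c1 - (- c2 - k) = k + (c2 - c1) by ring.
have steps (m : nat) : S1 (y + (m%:Z * (c2 - c1))%:~R *: x).
  elim: m => [|m /step]; first by rewrite mul0r scale0r addr0.
  by have -> : m%:Z * (c2 - c1) + (c2 - c1) = m.+1%:Z * (c2 - c1) by lia.
(* Any number of steps large against [c1] would do: if [c1 != c2], each step moves by at least one
   and the bound 4 is exceeded. *)
have := string_bound M1 Sx Sy (steps (`|c1| + 5)%N).
rewrite e1 e2 -[2]/(2%:~R) -intrM -intrD -intr_norm -[4]/(4%:~R) ler_int.
have [->//|ne] := eqVneq c1 c2.
move=> h; exfalso; move: h ne; rewrite PoszD; set d := c2 - c1.
have -> : c2 = c1 + d by rewrite /d; lia.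
clearbody d => h ne; have d0 : d != 0 by lia.
have {d0 ne} : d <= -1 \/ 1 <= d by lia.
have : - (`|c1|%N : int) <= c1 <= `|c1|%N by lia.
move: h; set k := (`|c1|%N : int); have : 0 <= k by rewrite /k.
clearbody k => k0 h hc [] hd.
  have : (k + 5) * d <= - (k + 5) by nia.
  lia.
have : (k + 5) <= (k + 5) * d by nia.
lia.
Qed.

Variables (e : R) (n : nat) (al : 'I_n -> F1).
Hypotheses (e2 : e * e = 1) (Ta : T a1 = e *: a2) (B : base S1 a1 al).
Hypotheses (Tinj : injective T) (Tsurj : forall y, exists x, T x = y).

Lemma image_comb c t : \sum_i c i *: T (al i) + t *: a2 =
  T (\sum_i c i *: al i + (e * t) *: a1).
Proof.
rewrite linearD linearZ /= Ta scalerA mulrAC e2 mul1r linear_sum; congr (_ + _).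
by apply: eq_bigr => i _; rewrite linearZ.
Qed.

Lemma image_base : base S2 a2 (T \o al).
Proof.
have e0 : e != 0 by apply: contra_eq_neq e2 => ->; rewrite mul0r eq_sym oner_neq0.
split=> /= [i|c t|y|y Sy].
- by apply/TS; exact: (base_S B).
- rewrite image_comb -(linear0 T) => /Tinj /(base_free B)[c0 /eqP].
  by rewrite mulf_eq0 (negPf e0) => /eqP t0; split.
- have [x <-] := Tsurj y; have [c [t ->]] := base_span B x.
  by exists c, (e * t); rewrite image_comb mulrA e2 mul1r.
have [x ex] := Tsurj y; move: Sy; rewrite -ex => /TS Sx.
have [c [t [-> sc]]] := base_sign B Sx.
by exists c, (e * t); rewrite image_comb mulrA e2 mul1r; split.
Qed.

End StringsAndImages.

Section Conjugacy.
Variables (R : realType) (F : vectType R) (I : {symmetric F}).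
Variables (S : set F) (a : F).
Local Notation cart := (cart I).
Hypothesis M : mers I S a.

(** The maps that occur are products of reflections, up to a global sign, with [e] equal to 1 or -1.
    A bare function keeps composition with [reflection] immediate. *)
Record automorphism (w : F -> F) (e : R) : Prop := Automorphism {
  auto_lin : forall c x y, w (c *: x + y) = c *: w x + w y;
  auto_a : w a = e *: a;
  auto_S : forall x, S x <-> S (w x);
  auto_form : forall x y, I (w x) (w y) = I x y;
  auto_surj : forall y, exists x, w x = y }.

Lemma auto_id : automorphism id 1.
Proof. by split=> //; [rewrite scale1r|move=> y; exists y]. Qed.

Lemma auto_refl w e x : automorphism w e -> S x ->
  automorphism (w \o reflection I x) e.
Proof.
move=> [wl wa wS wI ws] Sx; have xn := mers_nz M Sx.
split=> /= [c y z||y|y z|y].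
- by rewrite -wl !reflE cartDr cartZr; congr w; vring.
- by rewrite reflE /cart (formar M) mulr0 scale0r subr0.
- rewrite -wS; split=> h; first exact: (mers_refl M).
  by rewrite -(reflK xn y); apply: (mers_refl M).
- by rewrite wI form_refl.
- by have [z <-] := ws y; exists (reflection I x z); rewrite reflK.
Qed.

Lemma auto0 w e : automorphism w e -> w 0 = 0.
Proof.
by move=> W; have := auto_lin W (-1) 0 0; rewrite scaler0 add0r scaleN1r addNr.
Qed.

Lemma autoZ w e c x : automorphism w e -> w (c *: x) = c *: w x.
Proof. by move=> W; rewrite -[c *: x]addr0 (auto_lin W) (auto0 W) addr0. Qed.

Lemma autoD w e x y : automorphism w e -> w (x + y) = w x + w y.
Proof. by move=> W; rewrite -[x]scale1r (auto_lin W) !scale1r. Qed.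

Lemma auto_comb w e n (x : 'I_n -> F) (c : 'I_n -> R) t : automorphism w e ->
  w (comb a x c t) = \sum_i c i *: w (x i) + (t * e) *: a.
Proof.
move=> W; rewrite /comb (autoD _ _ W) (autoZ _ _ W) (auto_a W) scalerA; congr (_ + _).
elim/big_rec2: _ => [|i y z _ <-]; first exact: (auto0 W).
by rewrite (autoD _ _ W) (autoZ _ _ W).
Qed.

Lemma auto_opp w e : automorphism w e -> automorphism (fun x => - w x) (- e).
Proof.
move=> W; split=> [c x y||x|x y|y].
- by rewrite (auto_lin W) scalerN opprD.
- by rewrite (auto_a W) scaleNr.
- rewrite (auto_S W); split=> [|/(mers_opp M)]; first exact: (mers_opp M).
  by rewrite opprK.
- by rewrite formNl formNr opprK (auto_form W).
- have [x ex] := auto_surj W (- y); exists x; by rewrite ex opprK.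
Qed.

Lemma auto_cart w e x y : automorphism w e -> cart (w x) (w y) = cart x y.
Proof. by move=> W; rewrite /cart !(auto_form W). Qed.

Lemma base_dim n (al : 'I_n -> F) : base S a al -> \dim {:F} = n.+1.
Proof.
move=> B; have := base_tuple_free B; set X := [tuple of _] => fX.
have -> : fullv = <<X>>%VS.
  apply/vspaceP => x; rewrite memvf; apply/esym.
  have [c [t ->]] := base_span B x; apply: rpredD; last first.
    by apply/rpredZ/memv_span; rewrite mem_head.
  apply: rpred_sum => i _; apply/rpredZ/memv_span.
  rewrite inE; apply/orP; right; apply/tnthP; exists i.
  by rewrite tnth_mktuple.
by move: fX; rewrite /free => /eqP ->; rewrite size_tuple.
Qed.

Section Height.
Variables (n : nat) (be : 'I_n -> F) (h : {linear F -> R^o}).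
Hypotheses (B : base S a be) (h_be : forall i, h (be i) = 1) (h_a : h a = 0).

Lemma height_comb (c : 'I_n -> R) t : h (\sum_i c i *: be i + t *: a) = \sum_i c i.
Proof.
rewrite linearD linearZ /= h_a scaler0 addr0 linear_sum.
by apply: eq_bigr => i _; rewrite linearZ /= h_be -[RHS]mulr1.
Qed.

Lemma height_root x : S x -> h x <= -1 \/ 1 <= h x.
Proof.
move=> Sx; have [c [t [ex sc]]] := base_sign B Sx.
have [i ci] : exists i, c i != 0.
  apply: contrapT => /forallNP h0; have := mers_gt0 M Sx.
  rewrite ex [X in X + _]big1 => [|i _].
    by rewrite add0r formZl (mers_rad M) mulr0 ltxx.
  by move/negP: (h0 i); rewrite negbK => /eqP ->; rewrite scale0r.
rewrite ex height_comb -rmorph_sum /= -[-1]/((-1)%:~R) -[1]/(1%:~R) !ler_int.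
rewrite (bigD1 i) //=; set X := \sum_(_ | _) _; case: sc => hc; [right|left].
  have : 0 <= X by apply: sumr_ge0 => j _; apply: hc.
  by have := hc i; clearbody X; lia.
have : X <= 0 by apply: sumr_le0 => j _; apply: hc.
by have := hc i; clearbody X; lia.
Qed.

End Height.

Section TwoBases.
Variables (n m : nat) (ga : 'I_n -> F) (be : 'I_m -> F).
Hypotheses (Bg : base S a ga) (Bb : base S a be).

(** Fredholm alternative for the symmetric Gram matrix: its kernel is the line of [d], so
    orthogonality to [d] is the only obstruction. *)
Lemma gram_solve (d D : 'I_n -> R) : (forall i, 0 < d i) -> null_comb I ga d ->
  \sum_i d i * D i = 0 -> exists y : 'I_n -> R,
  forall j, \sum_i y i * I (ga i) (ga j) = D j.
Proof.
move=> d0 nd dD; pose A : 'M[R]_n := \matrix_(i, j) I (ga i) (ga j).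
have : (\row_j D j <= A)%MS.
  rewrite submxE; apply/eqP/rowP => k; rewrite mxE [RHS]mxE.
  have nx : null_comb I ga (fun j => cokermx A j k).
    move=> i; have /matrixP/(_ i k) := mulmx_coker A; rewrite !mxE => e.
    rewrite -[RHS]e; apply: eq_bigr => j _.
    by rewrite [A i j]mxE formC mulrC.
  have [t ht] := null_unique M Bg d0 nd nx.
  rewrite -[RHS](mulr0 t) -[in RHS]dD big_distrr /=.
  by apply: eq_bigr => j _; rewrite mxE ht; ring.
case/submxP=> y ey; exists (fun i => y 0 i) => j.
have /rowP/(_ j) := ey; rewrite !mxE => ->.
by apply: eq_bigr => i _; rewrite mxE.
Qed.

Lemma height_ex n' (al : 'I_n' -> F) : base S a al ->
  exists h : {linear F -> R^o}, (forall i, h (al i) = 1) /\ h a = 0.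
Proof.
move=> B; have [f [f1 f2]] := base_extension (F2 := R^o) 0 (fun=> 1) B.
by exists f.
Qed.

Section Descent.
Variables (h h' : {linear F -> R^o}) (s s' c : R).
Hypothesis h_ga : forall i, h (ga i) = 1.
Hypotheses (h'_be : forall i, h' (be i) = 1) (h'_a : h' a = 0).
Hypotheses (s0 : 0 < s) (s'0 : 0 < s').
Hypothesis cle : forall i, c * I (ga i) (ga i) <= 4 * s * s'.

(* v represents the difference of the functionals h' o w and h, rescaled to the
   same value on the null vector; each reflection in a simple root on which
   h' o w is negative shortens v by a fixed amount. *)
Lemma descent e (N : nat) w v : automorphism w e ->
  (forall x, I v x = s * h' (w x) - s' * h x) -> I v v < N%:R * c ->
  exists2 w', automorphism w' e & forall i, 0 <= h' (w' (ga i)).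
Proof.
elim: N w v => [|N IH] w v W ev lt.
  by move: lt; rewrite mul0r ltNge (mers_pos M).
have [all|] := pselect (forall i, 0 <= h' (w (ga i))); first by exists w.
move=> /existsNP[i /negP]; rewrite -ltNge => neg.
have Si := base_S Bg i; have i0 := base_gt0 M Bg i.
have Swi : S (w (ga i)) by rewrite -(auto_S W).
have mneg : h' (w (ga i)) <= -1.
  by case: (height_root Bb h'_be h'_a Swi) => // h1; lra.
set m' := h' (w (ga i)) in neg mneg.
(* Subtracting [k ga_i] from [v] accounts for composing [w] with the reflection in [ga_i]. *)
pose k := 2 * s * m' / I (ga i) (ga i).
have kI : k * I (ga i) (ga i) = 2 * s * m' by rewrite /k divfK // gt_eqF.
apply: (IH (w \o reflection I (ga i)) (v - k *: ga i)).
- exact: auto_refl.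
- move=> x; rewrite !formE ev /= reflE -scaleNr (autoD _ _ W) (autoZ _ _ W).
  rewrite linearD linearZ /= -/m'.
  have -> : k * I (ga i) x = s * m' * cart (ga i) x.
    by rewrite /k /cart; field; rewrite gt_eqF.
  rewrite /GRing.scale /=; ring.
have vg : I v (ga i) = s * m' - s' by rewrite ev h_ga mulr1.
have e1 : I (v - k *: ga i) (v - k *: ga i) = I v v + 2 * k * s'.
  rewrite !formE (formC I (ga i) v) vg kI; ring.
(* Heights of roots are integers, so negative means [m' <= -1]; with [cle] the norm drops by at
   least [c]. *)
have kc : 2 * k * s' <= - c.
  rewrite -(ler_pM2r i0).
  have -> : 2 * k * s' * I (ga i) (ga i) = 4 * s * s' * m'.
    by transitivity (2 * s' * (k * I (ga i) (ga i))); [ring|rewrite kI; ring].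
  have := cle i; have : 0 < s * s' by apply: mulr_gt0.
  nra.
rewrite e1; move: lt; rewrite -natr1 mulrDl mul1r; lra.
Qed.

End Descent.

(** After the descent all [w (ga i)] have height at least 1 in [be]. Each [be j] has height 1 and
    is, modulo [a], an integral combination of the [w (ga i)] with one sign, so only one term, with
    coefficient 1, can occur. *)
Lemma conj_bases : exists w e (f : 'I_n -> 'I_m) (g : 'I_m -> 'I_n) (t : 'I_n -> R),
  [/\ automorphism w e, e * e = 1, cancel f g, cancel g f
    & forall i, w (ga i) = be (f i) + t i *: a].
Proof.
have [h [h_ga h_a]] := height_ex Bg; have [h' [h'_be h'_a]] := height_ex Bb.
have [d d0 nd] := null_vec M Bg.
pose de := \sum_i d i *: ga i + 0 *: a.
have s0 : 0 < h de.
  rewrite /de (height_comb h_ga h_a); have [i _] := ind_card M Bg.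
  rewrite (bigD1 i) //=; apply: ltr_pwDl => //.
  by apply: sumr_ge0 => j _; apply: ltW.
(* In the base [be] the null vector also has coefficients of one strict sign; replacing the identity
   by [-1] if necessary makes its height positive. *)
have de0 : h' de != 0.
  have [x [t ex]] := base_span Bb de.
  have [b b0 nb] := null_vec M Bb.
  have nx : null_comb I be x.
    move=> j; rewrite -(form_comb M _ _ t) /comb -ex formC.
    have [y [u ->]] := base_span Bg (be j).
    rewrite -/(comb a ga y u) (form_comb M) big1 // => i _.
    by rewrite formC -/(comb a ga d 0) (form_comb M) nd mulr0.
  have [r hr] := null_unique M Bb b0 nb nx.
  have r0 : r != 0.
    apply: contraTneq s0 => r0; rewrite ex [X in X + _]big1 => [|j _].
      by rewrite add0r linearZ /= h_a scaler0 ltxx.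
    by rewrite hr r0 mul0r scale0r.
  rewrite ex (height_comb h'_be h'_a); under eq_bigr do rewrite hr.
  rewrite -big_distrr /= mulf_neq0 // gt_eqF //.
  have [j _] := ind_card M Bb; rewrite (bigD1 j) //=; apply: ltr_pwDl => //.
  by apply: sumr_ge0 => k _; apply: ltW.
have [w0 [e [W0 ee s'0]]] : exists w0 e,
    [/\ automorphism w0 e, e * e = 1 & 0 < h' (w0 de)].
  case: (ltP 0 (h' de)) => [p|np]; first by exists id, 1; rewrite mulr1;
    split=> //; apply: auto_id.
  exists (fun x => - x), (- 1); rewrite mulrNN mulr1; split=> //.
    exact: (auto_opp auto_id).
  by rewrite linearN oppr_gt0 lt_neqAle de0.
set s := h de in s0; set s' := h' (w0 de) in s'0.
have h'w w e' x t : automorphism w e' ->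
    h' (w (comb a ga x t)) = \sum_i x i * h' (w (ga i)).
  by move=> W; rewrite (auto_comb _ _ _ W) linearD linearZ /= h'_a scaler0 addr0
    linear_sum; apply: eq_bigr => i _; rewrite linearZ.
have es : s = \sum_i d i by exact: (height_comb h_ga h_a).
have es' : s' = \sum_i d i * h' (w0 (ga i)) by exact: (h'w _ _ _ _ W0).
clearbody s s'.
(* The factors [s] and [s'] make the two heights agree on the null vector, so [D] is orthogonal to
   [d] and can be represented by the form. *)
pose D j := s * h' (w0 (ga j)) - s'.
have [y hy] : exists y : 'I_n -> R, forall j, \sum_i y i * I (ga i) (ga j) = D j.
  apply: (gram_solve d0 nd); transitivity (s * s' - s' * s); last by ring.
  rewrite {1}es' {2}es !big_distrr -sumrB /=.
  by apply: eq_bigr => i _; rewrite /D; ring.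
pose v := comb a ga y 0.
have ev x : I v x = s * h' (w0 x) - s' * h x.
  have [c [t ->]] := base_span Bg x; rewrite (form_comb M) -/(comb a ga c t).
  rewrite (h'w _ _ _ _ W0) (height_comb h_ga h_a) !big_distrr -sumrB /=.
  transitivity (\sum_i c i * D i); last by apply: eq_bigr => i _; rewrite /D; ring.
  under [RHS]eq_bigr => i _ do rewrite -hy big_distrr.
  rewrite exchange_big; apply: eq_bigr => i _ /=.
  rewrite formC (form_comb M) big_distrr; apply: eq_bigr => j _ /=.
  by rewrite (formC I (ga j)); ring.
have [c c0 cle] : exists2 c, 0 < c & forall i, c * I (ga i) (ga i) <= 4 * s * s'.
  have p0 : 0 < \sum_i I (ga i) (ga i).
    have [i _] := ind_card M Bg; rewrite (bigD1 i) //=.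
    by apply: ltr_pwDl; [exact: (base_gt0 M Bg)|apply: sumr_ge0 => j _;
      exact: (mers_pos M)].
  exists (4 * s * s' / \sum_i I (ga i) (ga i)) => [|i].
    by rewrite divr_gt0 // !mulr_gt0.
  rewrite mulrAC ler_pdivrMr // ler_pM2l ?mulr_gt0 // (bigD1 i) //= lerDl.
  by apply: sumr_ge0 => j _; exact: (mers_pos M).
have [N lt] : exists N : nat, I v v < N%:R * c.
  exists (Num.bound (I v v / c)); rewrite -ltr_pdivrMr //.
  by apply: archi_boundP; rewrite divr_ge0 ?(mers_pos M) // ltW.
have [w W wpos] := descent h_ga h'_be h'_a s0 s'0 cle W0 ev lt.
have w1 i : 1 <= h' (w (ga i)).
  have Swi : S (w (ga i)) by rewrite -(auto_S W); exact: (base_S Bg).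
  by case: (height_root Bb h'_be h'_a Swi) => // h1; have := wpos i; lra.
have pre j : exists p : 'I_n * R, w (ga p.1) = be j + p.2 *: a.
  have [x ex] := auto_surj W (be j).
  have Sx : S x by rewrite (auto_S W) ex; exact: (base_S Bb).
  have [z [t [exz sz]]] := base_sign Bg Sx.
  have hx : \sum_i (z i)%:~R * h' (w (ga i)) = 1.
    by rewrite -(h'w _ _ _ t W) /comb -exz ex h'_be.
  have z0 i : 0 <= z i.
    case: sz => // zn; exfalso; move: hx; apply/eqP; rewrite lt_eqF //.
    apply: le_lt_trans ltr01; apply: sumr_le0 => k _.
    by rewrite mulr_le0_ge0 ?lerz0 // (le_trans ler01).
  have [i zi] : exists i, z i != 0.
    apply: contrapT => /forallNP h0; move: hx; apply/eqP.
    rewrite big1 => [|k _]; first by rewrite eq_sym oner_eq0.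
    by move/negP: (h0 k); rewrite negbK => /eqP ->; rewrite mul0r.
  have zi1 : 1 <= (z i)%:~R :> R by rewrite ler1z; have := z0 i; lia.
  have rest0 : 0 <= \sum_(k | k != i) (z k)%:~R * h' (w (ga k)).
    by apply: sumr_ge0 => k _; rewrite mulr_ge0 ?ler0z // (le_trans ler01).
  move: hx; rewrite (bigD1 i) //= => hx; have wi := w1 i.
  have zw : (z i)%:~R <= (z i)%:~R * h' (w (ga i)) :> R.
    by rewrite ler_peMr // (le_trans ler01).
  have zz : (z i)%:~R = 1 :> R.
    by apply/le_anti; rewrite zi1 andbT; apply: le_trans zw _; rewrite -[leRHS]hx lerDl.
  have r0 : \sum_(k | k != i) (z k)%:~R * h' (w (ga k)) = 0.
    apply/le_anti; rewrite rest0 andbT -(lerD2l ((z i)%:~R * h' (w (ga i)))) hx addr0.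
    exact: le_trans zi1 zw.
  have zk k : k != i -> (z k)%:~R = 0 :> R.
    move=> ki; apply/eqP/contraT => zk0.
    have p : 0 < (z k)%:~R * h' (w (ga k)).
      apply: mulr_gt0; last exact: lt_le_trans ltr01 (w1 k).
      by rewrite lt_neqAle eq_sym zk0 ler0z z0.
    move: r0; rewrite (bigD1 k) //= => r0; move: (r0); apply: contra_eqT => _.
    rewrite gt_eqF //; apply: ltr_pwDl => //.
    by apply: sumr_ge0 => l _; rewrite mulr_ge0 ?ler0z // (le_trans ler01).
  have xi : x = ga i + t *: a.
    by rewrite exz -/(comb a ga (fun i => (z i)%:~R) t) (@combZ _ _ a _ ga i (fun k
      => (z k)%:~R) t zk) zz scale1r.
  exists (i, - (e * t)) => /=; rewrite -ex xi (autoD _ _ W) (autoZ _ _ W) (auto_a W).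
  by rewrite scalerA scaleNr mulrC addrK.
have [p hp] : {p : 'I_m -> 'I_n * R & forall j, w (ga (p j).1) = be j + (p j).2 *: a}.
  exact: (choice pre).
pose g j := (p j).1.
have ginj : injective g.
  move=> j j' eg; have := hp j; rewrite -/(g j) eg hp !comb1 => /(comb_inj Bb)[/(_ j)].
  by rewrite eqxx; case: eqP => // _ /eqP; rewrite eq_sym oner_eq0.
have nm : n = m by have := base_dim Bg; rewrite (base_dim Bb) => -[].
have [f gK fK] : bijective g by apply: inj_card_bij => //; rewrite !card_ord nm.
exists w, e, f, g, (fun i => (p (f i)).2); split=> // i.
by rewrite -hp -/(g (f i)) fK.
Qed.

End TwoBases.
End Conjugacy.

(** The map [t] to [s + e t], with [e] equal to 1 or -1, carries one coset onto the other, so each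
    period is an integral multiple of the other. The offsets drop out, which is what makes fibres
    comparable across unknown shifts. *)
Lemma coset_period_eq (R : realType) (K1 K2 b1 b2 s e : R) :
  0 < K1 -> 0 < K2 -> e * e = 1 ->
  (forall t, (exists m : int, t = b1 + K1 * m%:~R) <->
             (exists m : int, s + e * t = b2 + K2 * m%:~R)) -> K1 = K2.
Proof.
move=> k1 k2 ee h.
have [m0 e0] : exists m : int, s + e * b1 = b2 + K2 * m%:~R.
  by apply/h; exists 0; rewrite mulr0 addr0.
have [m1 e1] : exists m : int, s + e * (b1 + K1) = b2 + K2 * m%:~R.
  by apply/h; exists 1; rewrite mulr1.
have [m2 e2] : exists m : int, e * (b2 - s) = b1 + K1 * m%:~R.
  apply/h; exists 0; rewrite mulrA ee; ring.
have [m3 e3] : exists m : int, e * (b2 + K2 - s) = b1 + K1 * m%:~R.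
  apply/h; exists 1; rewrite mulrA ee; ring.
have f1 : e * K1 = K2 * (m1 - m0)%:~R.
  transitivity ((s + e * (b1 + K1)) - (s + e * b1)); first by ring.
  by rewrite e1 e0 intrB; ring.
have f2 : e * K2 = K1 * (m3 - m2)%:~R.
  transitivity (e * (b2 + K2 - s) - e * (b2 - s)); first by ring.
  by rewrite e3 e2 intrB; ring.
move: f1 f2; set y := m1 - m0; set z := m3 - m2; clearbody y z => f1 f2.
have zy : y * z = 1.
  apply: (intr_inj (R := R)); apply: (mulfI (lt0r_neq0 k2)).
  rewrite mulr1 intrM mulrA -f1 -mulrA -f2 mulrA ee mul1r //.
have : y = 1 \/ y = -1.
  have : (`|y| %| 1)%N by apply/dvdnP; exists `|z|%N; nia.
  by rewrite dvdn1; lia.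
have ne : `|e| = 1.
  have : `|e| * `|e| = 1 by rewrite -normrM ee normr1.
  have := normr_ge0 e; nra.
have {f1} : `|e * K1| = `|K2 * y%:~R| by rewrite f1.
rewrite !normrM ne (gtr0_norm k1) (gtr0_norm k2) mul1r => ->.
by case=> ->; rewrite ?normrN normr1 mulr1.
Qed.

(** * From an isomorphism to equal data *)

Section Comparison.
Variables (R : realType) (F1 F2 : vectType R).
Variables (I1 : {symmetric F1}) (I2 : {symmetric F2}).
Variables (S1 : set F1) (S2 : set F2) (G1 : {vspace F1}) (G2 : {vspace F2}).
Variables (a1 : F1) (a2 : F2).
Hypotheses (HM1 : marked_elliptic I1 S1 G1) (HM2 : marked_elliptic I2 S2 G2).
Hypothesis Ha1 : generator (subgroup_gen S1 `&` [set x | x \in G1]) a1.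
Hypothesis Ha2 : generator (subgroup_gen S2 `&` [set x | x \in G2]) a2.
Variables (n1 n2 : nat).
Variables (P1 : n1.-tuple F1 * n1.-tuple F1) (P2 : n2.-tuple F2 * n2.-tuple F2).
Hypothesis HP1 : paired_simple_system S1 G1 a1 P1.
Hypothesis HP2 : paired_simple_system S2 G2 a2 P2.
Local Notation al1 := (tnth P1.1).
Local Notation al2 := (tnth P2.1).
Let M1 : mers I1 S1 a1 := marked_mers HM1 Ha1.
Let M2 : mers I2 S2 a2 := marked_mers HM2 Ha2.
Let B1 : base S1 a1 al1 := paired_base HM1 Ha1 HP1.
Let B2 : base S2 a2 al2 := paired_base HM2 Ha2 HP2.

Lemma compare_data (T : F1 -> F2) (e : R) f g (s : 'I_n1 -> R) :
  (forall c x t, T (c *: x + t *: a1) = c *: T x + (e * t) *: a2) ->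
  (forall x, S1 x <-> S2 (T x)) ->
  (forall x y, S1 x -> S1 y -> cart I1 x y = cart I2 (T x) (T y)) ->
  e * e = 1 -> cancel f g -> cancel g f ->
  (forall i, T (al1 i) = al2 (f i) + s i *: a2) ->
  data_iso I1 I2 S1 S2 G1 G2 a1 a2 P1 P2 f g.
Proof.
move=> Tl TS Tc ee fK gK Tal.
have Tfib c i t : S1 (c *: al1 i + t *: a1) <->
    S2 (c *: al2 (f i) + (c * s i + e * t) *: a2).
  rewrite TS Tl Tal; have -> // : c *: (al2 (f i) + s i *: a2) + (e * t) *: a2 =
    c *: al2 (f i) + (c * s i + e * t) *: a2 by vring.
have Tfib1 i t : S1 (al1 i + t *: a1) <-> S2 (al2 (f i) + (s i + e * t) *: a2).
  by have := Tfib 1 i t; rewrite !scale1r mul1r.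
have hn i : nonwhite S1 a1 P1 i <-> nonwhite S2 a2 P2 (f i).
  split=> -[t St]; first by exists (2 * s i + e * t); apply/Tfib.
  exists (e * (t - 2 * s i)); apply/Tfib; rewrite mulrA ee mul1r.
  by rewrite [2 * _ + _]addrC subrK.
have TZ c x : T (c *: x) = c *: T x.
  by rewrite -[c *: x]addr0 -(scale0r a1) Tl mulr0 scale0r addr0.
(* The shift [s i] blocks a direct transfer. If [2 al2] is not a root, the root over [al1] that [T]
   maps to [al2] has no double in [S1], and the pairing condition then forbids [2 al1] as well; the
   converse is symmetric. *)
have h2 i : S1 (2 *: al1 i) <-> S2 (2 *: al2 (f i)).
  split=> Sx; apply: contrapT => nSx.
    have ey : T (al1 i + (- (e * s i)) *: a1) = al2 (f i).
      rewrite -[al1 i]scale1r Tl scale1r Tal mulrN mulrA ee mul1r.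
      by rewrite scaleNr addrK.
    case: HP1 => _ _ /(_ i) pc _; case: pc => //.
    exists (al1 i + (- (e * s i)) *: a1); split.
    - by apply/TS; rewrite ey; exact: (base_S B2).
    - by apply/(proj_eq HM1 Ha1); exists (- (e * s i)).
    - by move/TS; rewrite TZ ey.
  case: HP2 => _ _ /(_ (f i)) pc _; case: pc => //.
  exists (T (al1 i)); split.
  - by apply/TS; exact: (base_S B1).
  - by apply/(proj_eq HM2 Ha2); exists (s i).
  - by rewrite -TZ => /TS.
split=> // [i j|i].
  rewrite Tc; [|exact: (base_S B1)|exact: (base_S B1)].
  by rewrite !Tal (cart_a M2) (cart_ar M2).
have ek : counting_number S1 a1 (al1 i) = counting_number S2 a2 (al2 (f i)).
  apply/eqP; rewrite -(eqr_nat R); apply/eqP.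
  apply: (@coset_period_eq _ _ _ 0 0 (s i) e) => // [||t].
  - exact: (kk_gt0 M1 B1 (base_S B1 i)).
  - exact: (kk_gt0 M2 B2 (base_S B2 (f i))).
  have := Tfib1 i t;
    rewrite (fibP M1 B1 _ (base_S B1 i)) (fibP M2 B2 _ (base_S B2 (f i))).
  move=> [h h']; split=> -[m em].
    have [|m' em'] := h; first by exists m; rewrite em add0r.
    by exists m'; rewrite add0r.
  have [|m' em'] := h'; first by exists m; rewrite em add0r.
  by exists m'; rewrite add0r.
split=> //.
have [nw|nw] := pselect (nonwhite S1 a1 P1 i); last first.
  have nw' : ~ nonwhite S2 a2 P2 (f i) by rewrite -hn.
  have [-> _ _] := white_data HM1 Ha1 HP1 nw.
  by have [-> _ _] := white_data HM2 Ha2 HP2 nw'; rewrite ek.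
have nw' : nonwhite S2 a2 P2 (f i) by rewrite -hn.
have q10 := q_gt0 HM1 Ha1 HP1 i; have q20 := q_gt0 HM2 Ha2 HP2 (f i).
case: (nonwhite_data HM1 Ha1 HP1 nw) => _ _ _ c1.
case: (nonwhite_data HM2 Ha2 HP2 nw') => _ _ _ c2.
case: c1 c2 => [[b1 h1]|[b1 h1]] [[b2 h2']|[b2 h2']]; try by [case: b1;
  apply/h2|case: b2; apply/h2].
  have : 2 * knr_at S1 G1 a1 P1 i = 2 * knr_at S2 G2 a2 P2 (f i).
    apply: (@coset_period_eq _ _ _ 0 0 (2 * s i) e); rewrite ?mulr_gt0 // => t.
    have := Tfib 2 i t; rewrite h1 h2' => -[h h']; split=> -[m em].
      have [|m' em'] := h; first by exists m; rewrite em add0r.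
      by exists m'; rewrite add0r.
    have [|m' em'] := h'; first by exists m; rewrite em add0r.
    by exists m'; rewrite add0r.
  by apply: mulfI; rewrite pnatr_eq0.
(* In the gray case the fibre over [2 al] is [2 q + 4 q Z], so its period is [4 q]. *)
have : 4 * knr_at S1 G1 a1 P1 i = 4 * knr_at S2 G2 a2 P2 (f i).
  apply: (@coset_period_eq _ _ _ (2 * knr_at S1 G1 a1 P1 i) (2 * knr_at S2 G2 a2 P2
    (f i))
    (2 * s i) e); rewrite ?mulr_gt0 // => t.
  by rewrite -h1 -h2'; apply: Tfib.
by apply: mulfI; rewrite pnatr_eq0.
Qed.

Lemma hom_subgroup_gen (V W : vectType R) (S : set V) (S' : set W)
    (T : {linear V -> W}) :
  (forall x, S x -> S' (T x)) ->
  forall x, subgroup_gen S x -> subgroup_gen S' (T x).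
Proof.
move=> TS x h; have sg := subgroup_genP S'.
apply: (h [set x | subgroup_gen S' (T x)]); split=> [|y /TS];
  last exact: sub_subgroup_gen.
split=> [|y z Sy Sz] /=; first by rewrite linear0; apply: sg.1.
by rewrite linearB; apply: sg.2.
Qed.

(** [T] and its inverse respect the groups generated by the roots and the marked lines, so [T a1] is
    [a2] or [- a2]. The images of the [al1 i] form a base of [S2], which some [w] conjugates to the
    [al2 i] up to shifts; [w \o T] is then fed to [compare_data]. *)
Lemma mers_data : mers_iso S1 G1 S2 G2 ->
  exists f g, data_iso I1 I2 S1 S2 G1 G2 a1 a2 P1 P2 f g.
Proof.
case=> T [[T' TK T'K] eS eG].
have TS x : S1 x <-> S2 (T x).
  rewrite -eS; split=> [Sx|[y Sy /(can_inj TK) <-//]]; by exists x.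
have T'E x : (T^-1)%VF x = T' x.
  have /lker0_lfunK lK : lker T == 0%VS by apply/lker0P; apply: can_inj TK.
  by rewrite -{1}(T'K x) lK.
have [ga1 aG1] := marked_gen Ha1; have [ga2 aG2] := marked_gen Ha2.
have [z ez] : exists z : int, T a1 = a2 *~ z.
  have : (subgroup_gen S2 `&` [set x | x \in G2]) (T a1).
    split; first by apply: hom_subgroup_gen ga1 => x /TS.
    by rewrite /= -eG memv_img.
  by rewrite Ha2 => -[z _ <-]; exists z.
have [y ey] : exists y : int, T' a2 = a1 *~ y.
  have : (subgroup_gen S1 `&` [set x | x \in G1]) (T' a2).
    split.
      have T'S x : S2 x -> S1 ((T^-1)%VF x) by rewrite T'E TS T'K.
      by rewrite -T'E; apply: hom_subgroup_gen ga2.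
    by move: aG2; rewrite -eG => /memv_imgP[x xG ->] /=; rewrite TK.
  by rewrite Ha1 => -[y _ <-]; exists y.
have zy : z * y = 1.
  have : a2 = a2 *~ (z * y) by rewrite -[LHS]T'K ey raddfMz /= ez mulrzA.
  move/eqP; rewrite -{1}[a2]mulr1z -subr_eq0 -mulrzBr -scaler_int scaler_eq0.
  by rewrite (negPf (mers_a0 M2)) orbF intr_eq0 subr_eq0 => /eqP.
pose e : R := z%:~R.
have ee : e * e = 1.
  rewrite /e -intrM; have -> // : z * z = 1.
  have : (`|z| %| 1)%N by apply/dvdnP; exists `|y|%N; nia.
  by rewrite dvdn1 => /eqP; nia.
have Ta : T a1 = e *: a2 by rewrite ez scaler_int.
have Tinj : injective T := can_inj TK.
have Tsurj x : exists x', T x' = x by exists (T' x).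
have Bi := image_base TS ee Ta B1 Tinj Tsurj.
have [w [e' [f [g [t [W ee' fK gK wf]]]]]] := conj_bases M2 Bi B2.
exists f, g; apply: (@compare_data (w \o T) (e * e') f g t) => //=.
- move=> c x u; rewrite linearD !linearZ /= Ta scalerA (autoD _ _ W) !(autoZ _ _ W).
  by rewrite (auto_a W) scalerA; congr (_ + _ *: _); ring.
- by move=> x; rewrite -(auto_S W).
- by move=> x u Sx Su; rewrite (auto_cart _ _ W); apply: (cart_hom M1 M2 TS).
by rewrite mulrACA ee ee' mulr1.
Qed.

End Comparison.

Theorem corollary8p13 (R : realType) (F1 F2 : vectType R)
    (I1 : {symmetric F1}) (I2 : {symmetric F2})
    (R1 : set F1) (R2 : set F2) (G1 : {vspace F1}) (G2 : {vspace F2})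
    (hR1 : marked_elliptic I1 R1 G1) (hR2 : marked_elliptic I2 R2 G2)
    (hnr1 : ~ reduced (root_quot R1 G1)) (hnr2 : ~ reduced (root_quot R2 G2))
    (a1 : F1) (a2 : F2)
    (ha1 : generator (subgroup_gen R1 `&` [set x | x \in G1]) a1)
    (ha2 : generator (subgroup_gen R2 `&` [set x | x \in G2]) a2)
    (l1 l2 : nat)
    (P1 : l1.+1.-tuple F1 * l1.+1.-tuple F1)
    (P2 : l2.+1.-tuple F2 * l2.+1.-tuple F2)
    (hP1 : paired_simple_system R1 G1 a1 P1)
    (hP2 : paired_simple_system R2 G2 a2 P2) :
  mers_iso R1 G1 R2 G2 <->
  diagram_iso (diagram_of I1 R1 G1 a1 P1) (diagram_of I2 R2 G2 a2 P2).
Proof.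
split=> [/(mers_data hR1 hR2 ha1 ha2 hP1 hP2)|
        /(diagram_data hR1 hR2 ha1 ha2 hP1 hP2)] [f [g h]].
  exact: (data_iso_diagram hR1 hR2 ha1 ha2 hP1 hP2 h).
exact: (data_iso_mers hR1 hR2 ha1 ha2 hP1 hP2 h).
Qed.
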